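(* Let $S$ be the collection of S-homotopy equivalences of $\mathbf{glCW}$. There exist a category $\mathbf{Ho}^S(\mathbf{glCW})$ and a functor $Q^S:\mathbf{glCW}\to\mathbf{Ho}^S(\mathbf{glCW})$ such that: (1) for every $s\in S$, $Q^S(s)$ is invertible in $\mathbf{Ho}^S(\mathbf{glCW})$; (2) for every functor $F:\mathbf{glCW}\to\mathcal C$ to a category $\mathcal C$ such that $F(s)$ is invertible in $\mathcal C$ for every $s\in S$, there exists a unique functor $G:\mathbf{Ho}^S(\mathbf{glCW})\to\mathcal C$ such that $F=G\circ Q^S$.
   Context: ''Category'' means a category whose objects are sets and in which the morphisms between any two objects form a set (a small hom-set). **Globe.** $\mathrm{Glob}(X)$ is the quotient of $X\times[0,1]$ by $(x,0)=(x',0)$ and $(x,1)=(x',1)$ for all $x,x'$; special points $\underline\iota$ (class of $(x,0)$) and $\underline\sigma$ (class of $(x,1)$); partially ordered by the image of $\{((x,t),(x,t')):t\le t'\}$. $\vec D^n=\mathrm{Glob}(D^{n-1})$, $\vec S^n=\mathrm{Glob}(S^{n-1})$ for $n\ge1$ ($D^n$ the closed unit disk, $S^{n-1}$ its boundary); $\vec S^0=\{\underline\iota,\underline\sigma\}$ discrete with trivial order; $\vec S^{n-1}\subset\vec D^n$. **Globular CW-complex.** Start with a discrete set $X^0$. Inductively $X^n$ is obtained from $X^{n-1}$ by attaching globular $n$-cells $\vec D^n_\alpha$ along continuous maps $\phi_\alpha:\vec S^{n-1}\to X^{n-1}$ with $\phi_\alpha(\underline\iota),\phi_\alpha(\underline\sigma)\in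 X^0$ and such that for every continuous non-decreasing $\phi:[0,1]\to\vec S^{n-1}$ with $\phi(0)=\underline\iota$, $\phi(1)=\underline\sigma$, there are $0=t_0<\dots<t_k=1$ with $\phi_\alpha\circ\phi(t_i)\in X^0$ such that (a) for each $0\le i\le k-1$, $\phi_\alpha\circ\phi([t_i,t_{i+1}])\subset\psi_i(\vec D^{d_i})$ for some globular cell of dimension $d_i\le n-1$ with characteristic map $\psi_i:\vec D^{d_i}\to X^{n-1}$; (b) $\phi_\alpha\circ\phi$ restricted to $[t_i,t_{i+1}]$ is non-decreasing (of the form $\psi_i\circ\delta$, $\delta$ continuous non-decreasing into $\vec D^{d_i}$); (c) $\phi_\alpha\circ\phi$ is non-constant. $X$ is $X^n$ for some $n$, or $\bigcup_nX^n$ with the weak topology. It is considered with its cellular decomposition and characteristic maps $\phi_\alpha:\vec D^{n_\alpha}\to X$. **Execution paths and morphisms.** An execution path of $X$ is a continuous $\gamma:[0,1]\to X$ for which there are $0=t_0<\dots<t_k=1$, $k\ge1$, with $\gamma(t_i)\in X^0$, such that each $\gamma|_{[t_i,t_{i+1}]}$ lies in the image $\phi_{\alpha_i}(\vec D^{n_{\alpha_i}})$ of one globular cell and is non-decreasing there (of the form $\phi_{\alpha_i}\circ\delta$, $\delta$ continuous non-decreasing); constant paths at points of $X^0$ are also execution paths. $\mathbf{glCW}$ is the category of globular CW-complexes with morphisms the continuous maps $f:X\to Y$ such that $f(X^0)\subset Y^0$ and $f\circ\gamma$ is a non-constant execution path of $Y$ for every non-constant execution path $\gamma$ of $X$. **S-homotopy.**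 Two morphisms $f,g:X\to Y$ of $\mathbf{glCW}$ are S-homotopic ($f\sim_Sg$) if there is a continuous $H:X\times[0,1]\to Y$ with $H(-,0)=f$, $H(-,1)=g$ and $H(-,t)$ a morphism of globular CW-complexes for every $t$. A morphism $f:X\to Y$ is an S-homotopy equivalence if there is a morphism $g:Y\to X$ with $f\circ g\sim_S\mathrm{Id}_Y$ and $g\circ f\sim_S\mathrm{Id}_X$. *)

(* Defs.v *)
From HB Require Import structures.
From mathcomp Require Import all_boot all_order all_algebra generic_quotient.
From mathcomp Require Import all_classical all_reals all_analysis.
From Stdlib Require Import Relation_Operators.
Import numFieldNormedType.Exports.
Import Order.TTheory GRing.Theory Num.Theory.

Set Implicit Arguments.
Unset Strict Implicit.
Unset Printing Implicit Defensive.

Local Open Scope classical_set_scope.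
Local Open Scope ring_scope.
Local Open Scope quotient_scope.

(* The universe of hom makes the hom-sets small: it is that of the carriers of
   topological spaces, strictly below the universe of the type globCW of
   globular CW-complexes. *)
Record category := Category {
  obj :> Type;
  hom : obj -> obj -> Type@{Topological.axioms_.u0};
  id_hom : forall X, hom X X;
  comp_hom : forall X Y Z, hom Y Z -> hom X Y -> hom X Z;
  comp_id_l : forall X Y (f : hom X Y), comp_hom (id_hom Y) f = f;
  comp_id_r : forall X Y (f : hom X Y), comp_hom f (id_hom X) = f;
  comp_assoc : forall W X Y Z (h : hom Y Z) (g : hom X Y) (f : hom W X),
    comp_hom h (comp_hom g f) = comp_hom (comp_hom h g) f
}.
Arguments hom {c} X Y.
Arguments id_hom {c} X.
Arguments comp_hom {c X Y Z} g f.

Definition invertible (C : category) (X Y : C) (f : hom X Y) : Prop :=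
  exists g : hom Y X, comp_hom g f = id_hom X /\ comp_hom f g = id_hom Y.

Record functor (C D : category) := Functor {
  fobj :> C -> D;
  fmor : forall X Y : C, hom X Y -> hom (fobj X) (fobj Y);
  fmor_id : forall X : C, fmor (id_hom X) = id_hom (fobj X);
  fmor_comp : forall (X Y Z : C) (g : hom Y Z) (f : hom X Y),
    fmor (comp_hom g f) = comp_hom (fmor g) (fmor f)
}.
Arguments fmor {C D} _ {X Y} _.

Program Definition comp_functor (B C D : category)
    (G : functor C D) (F : functor B C) : functor B D :=
  {| fobj := fun X => G (F X);
     fmor := fun X Y f => fmor G (fmor F f) |}.
Next Obligation. by move=> B C D G F X /=; rewrite !fmor_id. Qed.
Next Obligation. by move=> B C D G F X Y Z g f /=; rewrite !fmor_comp. Qed.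

Definition unitI (R : realType) : Type := (`[0, 1]%classic : set R).
HB.instance Definition _ (R : realType) := Topological.on (unitI R).
Definition unitI_val (R : realType) : unitI R -> R := set_val.
Coercion unitI_val : unitI >-> Real.sort.

Lemma zero_in_unitI (R : realType) : `[0, 1]%classic (0 : R).
Proof. by rewrite /= in_itv /= lexx ler01. Qed.

Lemma one_in_unitI (R : realType) : `[0, 1]%classic (1 : R).
Proof. by rewrite /= in_itv /= lexx ler01. Qed.

Definition unitI0 (R : realType) : unitI R := SigSub (mem_set (zero_in_unitI R)).
Definition unitI1 (R : realType) : unitI R := SigSub (mem_set (one_in_unitI R)).

Section globe.
Context {R : realType} (Z : topologicalType).

Let glob_rel' (u v : Z * unitI R) : bool :=
  (u == v) || ((u.2 == v.2) && ((u.2 == unitI0 R) || (u.2 == unitI1 R))).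

Local Lemma glob_rel_refl : reflexive glob_rel'.
Proof. by move=> u; rewrite /glob_rel' eqxx. Qed.

Local Lemma glob_rel_sym : symmetric glob_rel'.
Proof.
move=> u v; rewrite /glob_rel' (eq_sym u) (eq_sym u.2).
by case: (v.2 =P u.2) => [->|].
Qed.

Local Lemma glob_rel_trans : transitive glob_rel'.
Proof.
move=> v u w /predU1P[->//|/andP[/eqP uv ue]] /predU1P[<-|/andP[/eqP vw _]].
  by rewrite /glob_rel' uv eqxx -uv ue orbT.
by rewrite /glob_rel' uv vw eqxx -vw -uv ue orbT.
Qed.

Definition glob_rel := EquivRel _ glob_rel_refl glob_rel_sym glob_rel_trans.

Definition glob := {eq_quot glob_rel}.
HB.instance Definition _ := Topological.copy glob (quotient_topology glob).
HB.instance Definition _ := Quotient.on glob.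

(* The special points are given as subsets {iota} and {sigma}, which are
   singletons when Z is nonempty, since Glob of the empty space is empty. *)
Definition glob_iota : set glob := [set \pi_glob (x, unitI0 R) | x in setT].
Definition glob_sigma : set glob := [set \pi_glob (x, unitI1 R) | x in setT].

Definition glob_le (u v : glob) : Prop :=
  exists (x : Z) (t t' : unitI R),
    [/\ (t : R) <= (t' : R), u = \pi_glob (x, t) & v = \pi_glob (x, t')].

End globe.
Arguments glob R Z : clear implicits.

(* The choice of the representative of u does not matter: the map
   (x, t) |-> (f x, t) is compatible with the identifications. *)
Definition glob_map (R : realType) (Z Z' : topologicalType) (f : Z -> Z') :
    glob R Z -> glob R Z' :=
  fun u => \pi_(glob R Z') (f (repr u).1, (repr u).2).

Definition disk (R : realType) (n : nat) : set 'rV[R]_n :=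
  [set x | \sum_(i < n) x 0 i ^+ 2 <= 1].

(* S^(n-1), the boundary of D^n; it is empty for n = 0. *)
Definition sphere (R : realType) (n : nat) : set 'rV[R]_n :=
  [set x | \sum_(i < n) x 0 i ^+ 2 = 1].
Arguments disk R n : clear implicits.
Arguments sphere R n : clear implicits.

Lemma sphere_sub_disk (R : realType) (n : nat) : sphere R n `<=` disk R n.
Proof. by move=> x; rewrite /sphere /disk /= => ->. Qed.

Definition sphere_incl (R : realType) (n : nat) (x : sphere R n) : disk R n :=
  SigSub (mem_set (@sphere_sub_disk R n _ (set_valP x))).

Lemma zero_in_disk (R : realType) (n : nat) : disk R n 0.
Proof.
by rewrite /disk /= big1 ?ler01// => i _; rewrite mxE expr0n.
Qed.

Definition disk0 (R : realType) (n : nat) : disk R n :=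
  SigSub (mem_set (@zero_in_disk R n)).

(* The globular disk of dimension n + 1 (there is none of dimension 0). *)
Definition gdisk (R : realType) (n : nat) : topologicalType :=
  glob R (disk R n).

(* The globular sphere of dimension n; in dimension 0 it is the discrete space
   {iota, sigma}, with iota = false and sigma = true. *)
Definition gsphere (R : realType) (n : nat) : topologicalType :=
  match n return topologicalType with
  | 0%N => bool
  | m.+1 => glob R (sphere R m.+1)
  end.

Definition gsphere_le (R : realType) (n : nat) :
    gsphere R n -> gsphere R n -> Prop :=
  match n return gsphere R n -> gsphere R n -> Prop with
  | 0%N => fun b b' => b = b'
  | m.+1 => @glob_le R (sphere R m.+1)
  end.

Definition gsphere_iota (R : realType) (n : nat) : set (gsphere R n) :=
  match n return set (gsphere R n) with
  | 0%N => [set false]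
  | m.+1 => @glob_iota R (sphere R m.+1)
  end.

Definition gsphere_sigma (R : realType) (n : nat) : set (gsphere R n) :=
  match n return set (gsphere R n) with
  | 0%N => [set true]
  | m.+1 => @glob_sigma R (sphere R m.+1)
  end.

(* The inclusion of the globular sphere of dimension n as the boundary of the
   globular disk of dimension n + 1. *)
Definition gsphere_incl (R : realType) (n : nat) : gsphere R n -> gdisk R n :=
  match n return gsphere R n -> gdisk R n with
  | 0%N => fun b =>
      \pi_(glob R (disk R 0)) (disk0 R 0, if b then unitI1 R else unitI0 R)
  | m.+1 => glob_map (@sphere_incl R m.+1)
  end.

(* B is obtained from A by attaching a copy of D for each c : C along
   phi c : S -> A, with characteristic maps Phi: the canonical map from the
   disjoint union of A and the copies of D to X has image B and induces a
   homeomorphism onto B from the quotient by the relation that identifies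
   j s in the c-th copy of D with phi c s. *)

Section attaching.
Context {X : topologicalType} (A B : set X) {S D : topologicalType}
  (j : S -> D) {C : Type} (phi : C -> S -> A) (Phi : C -> D -> X).

Inductive glue : A + C * D -> A + C * D -> Prop :=
  Glue c s : glue (inl (phi c s)) (inr (c, j s)).

Definition attaching_map (u : A + C * D) : X :=
  match u with inl a => set_val a | inr (c, d) => Phi c d end.

Record obtained_by_attaching : Prop := {
  attaching_continuous : forall c, continuous (phi c);
  attaching_range : range attaching_map = B;
  attaching_kernel : forall u v,
    attaching_map u = attaching_map v <-> clos_refl_sym_trans _ glue u v;
  attaching_topology : forall U : set X,
    open (set_val @^-1` U : set B) <->
    open (set_val @^-1` U : set A) /\ forall c, open (Phi c @^-1` U)
}.

End attaching.
Arguments obtained_by_attaching {X} A B {S D} j {C} phi Phi.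

Definition subdivision (R : realType) (k : nat) (t : nat -> unitI R) : Prop :=
  [/\ (0 < k)%N, t 0%N = unitI0 R, t k = unitI1 R &
      forall i, (i < k)%N -> (t i : R) < (t i.+1 : R)].

Definition unitI_itv (R : realType) (a b : unitI R) : set (unitI R) :=
  [set s | (a : R) <= (s : R) <= (b : R)].

Definition directed_in_cell (R : realType) (X : topologicalType) (n : nat)
    (psi : gdisk R n -> X) (gamma : unitI R -> X) (I : set (unitI R)) : Prop :=
  exists delta : unitI R -> gdisk R n,
    [/\ {within I, continuous delta},
        forall s s', I s -> I s' -> (s : R) <= (s' : R) ->
          glob_le (delta s) (delta s') &
        forall s, I s -> gamma s = psi (delta s)].

(* X0 plays the role of the 0-skeleton; chr n lists the characteristic maps of
   the cells of dimension n + 1, and only those with N n may be used. *)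
Definition piecewise_directed (R : realType) (X : topologicalType)
    (X0 : set X) (cell : nat -> Type)
    (chr : forall n, cell n -> gdisk R n -> X) (N : set nat)
    (gamma : unitI R -> X) : Prop :=
  exists (k : nat) (t : nat -> unitI R),
    [/\ subdivision k t,
        forall i, (i <= k)%N -> X0 (gamma (t i)) &
        forall i, (i < k)%N -> exists n (c : cell n),
          N n /\ directed_in_cell (chr n c) gamma (unitI_itv (t i) (t i.+1))].

Definition nonconstant (T U : Type) (f : T -> U) : Prop :=
  ~ exists u, forall s, f s = u.

(* The n-skeleton skel n is a subspace of the complex.  The filtration may be
   stationary, so the finite-dimensional case is included. *)
Record globCW (R : realType) := GlobCW {
  space :> topologicalType;
  skel : nat -> set space;
  (* indices and characteristic maps of the cells of dimension n + 1,
     which are attached to skel n *)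
  cell : nat -> Type@{Topological.axioms_.u0};
  att : forall n, cell n -> gsphere R n -> skel n;
  chr : forall n, cell n -> gdisk R n -> space;
  skel0_discrete : forall U : set (skel 0), open U;
  skelS_attaching : forall n,
    obtained_by_attaching (skel n) (skel n.+1) (@gsphere_incl R n)
      (@att n) (@chr n);
  att_ends : forall n (c : cell n) u, gsphere_iota u \/ gsphere_sigma u ->
    skel 0 (set_val (att c u));
  att_directed : forall n (c : cell n) (phi : unitI R -> gsphere R n),
    continuous phi ->
    (forall s s' : unitI R, (s : R) <= (s' : R) -> gsphere_le (phi s) (phi s')) ->
    gsphere_iota (phi (unitI0 R)) -> gsphere_sigma (phi (unitI1 R)) ->
    piecewise_directed (skel 0) (@chr) [set m | (m < n)%N]
      (fun s => set_val (att c (phi s))) /\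
    nonconstant (fun s => set_val (att c (phi s)));
  skel_exhaustive : \bigcup_n skel n = setT;
  weak_topology : forall U : set space,
    open U <-> forall n, open (set_val @^-1` U : set (skel n))
}.

Arguments skel {R} _ n _.
Arguments cell {R} _ n.

Definition execution_path (R : realType) (X : globCW R) (gamma : unitI R -> X) :
    Prop :=
  continuous gamma /\
  (piecewise_directed (skel X 0) (@chr R X) setT gamma \/
   exists2 x, skel X 0 x & forall s, gamma s = x).

Definition is_glCW_morphism (R : realType) (X Y : globCW R) (f : X -> Y) :
    Prop :=
  [/\ continuous f,
      forall x, skel X 0 x -> skel Y 0 (f x) &
      forall gamma : unitI R -> X, execution_path gamma -> nonconstant gamma ->
        execution_path (f \o gamma) /\ nonconstant (f \o gamma)].

Record glCW_hom (R : realType) (X Y : globCW R) := GlCWHom {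
  glCW_fun :> X -> Y;
  glCW_funP : is_glCW_morphism glCW_fun
}.

Lemma glCW_hom_eq (R : realType) (X Y : globCW R) (f g : glCW_hom X Y) :
  (f : X -> Y) = g -> f = g.
Proof.
by case: f g => [f fP] [g gP] /= fg; subst g; rewrite (Prop_irrelevance fP gP).
Qed.

Lemma glCW_id_proof (R : realType) (X : globCW R) :
  is_glCW_morphism (idfun : X -> X).
Proof. by split => // x; exact: cvg_id. Qed.

Lemma glCW_comp_proof (R : realType) (X Y Z : globCW R)
    (g : glCW_hom Y Z) (f : glCW_hom X Y) :
  is_glCW_morphism (g \o f : X -> Z).
Proof.
case: g f => [g [gc g0 gP]] [f [fc f0 fP]] /=; split.
- by move=> x; apply: continuous_comp; [exact: fc|exact: gc].
- by move=> x /f0 /g0.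
- by move=> gamma ge gn; have [fe fn] := fP _ ge gn; exact: gP fe fn.
Qed.

Definition glCW_id (R : realType) (X : globCW R) : glCW_hom X X :=
  GlCWHom (glCW_id_proof X).

Definition glCW_comp (R : realType) (X Y Z : globCW R)
    (g : glCW_hom Y Z) (f : glCW_hom X Y) : glCW_hom X Z :=
  GlCWHom (glCW_comp_proof g f).

Program Definition glCW (R : realType) : category :=
  {| obj := globCW R;
     hom := @glCW_hom R;
     id_hom := @glCW_id R;
     comp_hom := @glCW_comp R |}.
Next Obligation. by move=> R X Y f; exact: glCW_hom_eq. Qed.
Next Obligation. by move=> R X Y f; exact: glCW_hom_eq. Qed.
Next Obligation. by move=> R W X Y Z h g f; exact: glCW_hom_eq. Qed.

Definition S_homotopic (R : realType) (X Y : globCW R) (f g : glCW_hom X Y) :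
    Prop :=
  exists H : X * unitI R -> Y,
    [/\ continuous H,
        forall x, H (x, unitI0 R) = f x,
        forall x, H (x, unitI1 R) = g x &
        forall t, is_glCW_morphism (fun x => H (x, t))].

Definition S_homotopy_equivalence (R : realType) (X Y : globCW R)
    (f : glCW_hom X Y) : Prop :=
  exists g : glCW_hom Y X,
    S_homotopic (glCW_comp f g) (glCW_id Y) /\
    S_homotopic (glCW_comp g f) (glCW_id X).

(* Main.v *)
From HB Require Import structures.
From mathcomp Require Import all_boot all_order all_algebra generic_quotient.
From mathcomp Require Import all_classical all_reals all_analysis.
From mathcomp Require Import ring lra.
From Stdlib Require Import Relation_Operators.
Require Import Defs.
Import numFieldNormedType.Exports.
Import Order.TTheory GRing.Theory Num.Theory.

Set Implicit Arguments.
Unset Strict Implicit.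
Unset Printing Implicit Defensive.

Local Open Scope classical_set_scope.
Local Open Scope ring_scope.
Local Open Scope quotient_scope.

(* The homotopy category has the same objects as glCW, and its morphisms are
   the classes of morphisms of glCW for the congruence that identifies f and g
   when F f = F g for every functor F inverting the S-homotopy equivalences.
   The universal property is then immediate, and this quotient inverts the
   S-homotopy equivalences as soon as S-homotopic morphisms are congruent.

   For this one needs a cylinder.  Collapsing {x} * [0, 1] to a point in
   X * [0, 1] for each x in the 0-skeleton gives a globular CW-complex: the
   product of a cell Glob(D^n) with [0, 1] has two cells Glob(D^n) as its ends
   and a cell Glob(D^n * [0, 1]) = Glob(D^(n+1)) in between.  An S-homotopy
   from X to Y is the same as a morphism from the cylinder to Y, because an
   execution path of the cylinder has a constant [0, 1]-coordinate on each of
   its pieces.  The two ends are sections of the projection onto X, which is an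
   S-homotopy equivalence by contraction of [0, 1]; hence F sends both ends,
   and so both ends of any S-homotopy, to the same morphism. *)

(** * Topology of the unit interval *)

(** The topological obstacle is that the product of a quotient map with an identity need not be a
    quotient map, while Glob(Z) * [0, 1], X * [0, 1] and the cylinder times [0, 1] must be
    understood cell by cell. [closed_prod_unitI] removes it: closedness in B * [0, 1] is reduced to
    closed slices and to closed projections onto B along compact sets, and the latter can be checked
    on whatever determines the closed sets of B. This is why closed sets are preferred to open ones
    throughout.

    The collapse over the 0-skeleton is forced, since a cell has points as poles and not intervals.
    It loses nothing: Y^0 is discrete, so a homotopy through morphisms to Y is constant on {x} *
    [0, 1] for x in X^0.

    Identifying morphisms by means of all functors makes transitivity and compatibility with
    composition automatic, so S-homotopies never have to be concatenated. *)

Lemma continuous_compose (T U V : topologicalType) (f : T -> U) (g : U -> V) :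
  continuous f -> continuous g -> continuous (g \o f).
Proof. by move=> fc gc x; apply: continuous_comp; [exact: fc|exact: gc]. Qed.

Lemma continuous_pair (T U V : topologicalType) (f : T -> U) (g : T -> V) :
  continuous f -> continuous g -> continuous (fun x => (f x, g x)).
Proof. by move=> fc gc x; apply: cvg_pair; [exact: fc|exact: gc]. Qed.

Lemma closed_preimage (T U : topologicalType) (f : T -> U) (D : set U) :
  continuous f -> closed D -> closed (f @^-1` D).
Proof. by move=> /continuous_closedP fc; exact: fc. Qed.

Lemma closed_ext (T : topologicalType) (A B : set T) :
  closed A -> (forall x, A x <-> B x) -> closed B.
Proof. by move=> Ac AB; suff <- : A = B by []; apply/seteqP; split=> x /AB. Qed.

Lemma continuous_id (T : topologicalType) : continuous (@id T).
Proof. by move=> x; exact: cvg_id. Qed.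

Lemma continuous_fst (T U : topologicalType) : continuous (@fst T U).
Proof. by move=> x; exact: cvg_fst. Qed.

Lemma continuous_snd (T U : topologicalType) : continuous (@snd T U).
Proof. by move=> x; exact: cvg_snd. Qed.

Lemma continuous_set_val (T : topologicalType) (A : set T) :
  continuous (set_val : A -> T).
Proof. exact: (@initial_continuous A T set_val). Qed.

Lemma continuous_set_type (T U : topologicalType) (A : set U) (f : T -> A) :
  continuous (set_val \o f) -> continuous f.
Proof.
move=> /continuousP fc; apply/continuousP => _ [W Wo <-].
exact: fc W Wo.
Qed.

Lemma continuous_rV (R : realType) (T : topologicalType) n (f : T -> 'rV[R]_n) :
  (forall i, continuous (fun x => f x 0 i)) -> continuous f.
Proof.
move=> fc x U [P Pn PU].
have : \forall y \near x, forall i, P 0 i (f y 0 i).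
  by apply: filter_forall => i; apply: (fc i x); exact: Pn.
by apply: filterS => y Py; apply: PU => i j; rewrite ord1.
Qed.

Section real_functions.
Context {R : realType} {T : topologicalType}.
Implicit Types f g : T -> R.

Lemma continuous_addr f g :
  continuous f -> continuous g -> continuous (fun x => f x + g x).
Proof. by move=> fc gc x; apply: cvgD; [exact: fc|exact: gc]. Qed.

Lemma continuous_subr f g :
  continuous f -> continuous g -> continuous (fun x => f x - g x).
Proof. by move=> fc gc x; apply: cvgB; [exact: fc|exact: gc]. Qed.

Lemma continuous_mulr f g :
  continuous f -> continuous g -> continuous (fun x => f x * g x).
Proof. by move=> fc gc x; apply: cvgM; [exact: fc|exact: gc]. Qed.

Lemma continuous_invr f :
  continuous f -> (forall x, f x != 0) -> continuous (fun x => (f x)^-1).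
Proof. by move=> fc f0 x; apply: cvgV; [exact: f0|exact: fc]. Qed.

Lemma continuous_sqrtr f : continuous f -> continuous (fun x => Num.sqrt (f x)).
Proof. by move=> fc; apply: (continuous_compose fc); exact: sqrt_continuous. Qed.

Lemma continuous_cst (y : R) : continuous (fun _ : T => y).
Proof. by move=> x; exact: cvg_cst. Qed.

Lemma continuous_sumr n (F : 'I_n -> T -> R) :
  (forall i, continuous (F i)) -> continuous (fun x => \sum_i F i x).
Proof.
elim: n F => [|n IHn] F Fc.
  by under eq_fun do rewrite big_ord0; exact: continuous_cst.
under eq_fun do rewrite big_ord_recl.
by apply: continuous_addr; [exact: Fc|apply: IHn => i; exact: Fc].
Qed.

End real_functions.

Lemma set_val_mk (T : Type) (A : set T) x (Ax : A x) :
  set_val (SigSub (mem_set Ax) : A) = x.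
Proof. by rewrite set_valE. Qed.

Section unit_interval.
Context {R : realType}.
Implicit Types s t u : unitI R.

Lemma unitI_ge0 s : 0 <= (s : R).
Proof. by have := set_valP s; rewrite /= in_itv => /andP[]. Qed.

Lemma unitI_le1 s : (s : R) <= 1.
Proof. by have := set_valP s; rewrite /= in_itv => /andP[]. Qed.

Lemma unitI_inj : injective (@unitI_val R).
Proof. exact: val_inj. Qed.

Lemma mk_unitI_subproof (x : R) : 0 <= x <= 1 -> `[0, 1]%classic x.
Proof. by rewrite /= in_itv. Qed.

Definition mk_unitI (x : R) (x01 : 0 <= x <= 1) : unitI R :=
  SigSub (mem_set (mk_unitI_subproof x01)).

Lemma unitI_val0 : (unitI0 R : R) = 0. Proof. exact: set_val_mk. Qed.
Lemma unitI_val1 : (unitI1 R : R) = 1. Proof. exact: set_val_mk. Qed.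

Lemma mk_unitIE (x : R) (x01 : 0 <= x <= 1) : (mk_unitI x01 : R) = x.
Proof. exact: set_val_mk. Qed.

Lemma continuous_unitI_val : continuous (@unitI_val R).
Proof. exact: continuous_set_val. Qed.

Lemma continuous_unitI (T : topologicalType) (f : T -> unitI R) :
  continuous (fun x => f x : R) -> continuous f.
Proof. exact: continuous_set_type. Qed.

Lemma unitI01 : unitI0 R <> unitI1 R.
Proof.
by move=> /(congr1 (@unitI_val R)) /eqP; rewrite unitI_val0 unitI_val1 eq_sym oner_eq0.
Qed.

Lemma continuous_clamp (T : topologicalType) (f : T -> R) (a b : R) :
  continuous f -> continuous (fun x => Num.max a (Num.min (f x) b)).
Proof.
move=> fc x; apply: (@continuous_max R T (cst a) (f \min cst b) x).
  exact: cvg_cst.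
by apply: (@continuous_min R T f (cst b) x); [exact: fc|exact: cvg_cst].
Qed.

Lemma unitI_retraction_subproof (x : R) : 0 <= Num.max 0 (Num.min x 1) <= 1.
Proof. by rewrite le_max lexx ge_max ler01 ge_min lexx orbT. Qed.

(** This map brings in results on the real line: [unitI R] is the image under it of a segment and of
    R, and precomposition with it turns paths into functions on R. *)
Definition unitI_retraction (x : R) : unitI R :=
  mk_unitI (unitI_retraction_subproof x).

Lemma unitI_retractionK s : unitI_retraction s = s.
Proof.
apply: unitI_inj; rewrite mk_unitIE.
by rewrite min_l ?unitI_le1// max_r ?unitI_ge0.
Qed.

Lemma continuous_unitI_retraction : continuous unitI_retraction.
Proof.
apply: continuous_unitI; under eq_fun do rewrite mk_unitIE.
by apply: (continuous_clamp (f := id)); exact: continuous_id.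
Qed.

Lemma unitI_compact : compact [set: unitI R].
Proof.
have -> : [set: unitI R] = unitI_retraction @` `[0, 1]%classic.
  apply/seteqP; split => // s _; exists (s : R); last exact: unitI_retractionK.
  exact: set_valP.
apply: continuous_compact; last exact: segment_compact.
by apply: continuous_subspaceT; exact: continuous_unitI_retraction.
Qed.

Lemma unitI_connected : connected [set: unitI R].
Proof.
have -> : [set: unitI R] = unitI_retraction @` setT.
  by apply/seteqP; split => // s _; exists (s : R) => //; exact: unitI_retractionK.
apply: connected_continuous_connected; first exact/connected_intervalP.
by apply: continuous_subspaceT; exact: continuous_unitI_retraction.
Qed.

Lemma clip_subproof (a b s : unitI R) :
  0 <= Num.max (a : R) (Num.min (s : R) (b : R)) <= 1.
Proof.
by rewrite le_max unitI_ge0 ge_max unitI_le1 ge_min unitI_le1.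
Qed.

(** For a <= b, the retraction of the unit interval onto [a, b]. Precomposing with it extends what
    is known on one piece of a path to the whole interval. *)
Definition clip (a b s : unitI R) : unitI R := mk_unitI (clip_subproof a b s).

Lemma clip_itv (a b s : unitI R) : (a : R) <= (b : R) -> unitI_itv a b (clip a b s).
Proof.
rewrite /unitI_itv /= mk_unitIE => ab.
by rewrite le_max lexx ge_max ab ge_min lexx orbT.
Qed.

Lemma clip_id (a b s : unitI R) : unitI_itv a b s -> clip a b s = s.
Proof.
move=> /andP[as_ sb]; apply: unitI_inj.
by rewrite mk_unitIE min_l// max_r.
Qed.

Lemma clip_homo (a b s t : unitI R) : (s : R) <= (t : R) -> (clip a b s : R) <= (clip a b t : R).
Proof.
move=> st; rewrite !mk_unitIE; apply: le_max2 => //.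
exact: le_min2.
Qed.

Lemma continuous_clip (a b : unitI R) : continuous (clip a b).
Proof.
apply: continuous_unitI; under eq_fun do rewrite mk_unitIE.
by apply: (continuous_clamp (f := @unitI_val R)); exact: continuous_unitI_val.
Qed.

Lemma unitI_mul_subproof s t : 0 <= (s : R) * (t : R) <= 1.
Proof.
have := unitI_ge0 s; have := unitI_ge0 t; have := unitI_le1 s.
have := unitI_le1 t; nra.
Qed.

Definition unitI_mul s t : unitI R := mk_unitI (unitI_mul_subproof s t).

Lemma continuous_unitI_mul : continuous (fun v => unitI_mul v.1 v.2).
Proof.
apply: continuous_unitI; under eq_fun do rewrite mk_unitIE.
apply: continuous_mulr.
  exact: continuous_compose (@continuous_fst _ _) continuous_unitI_val.
exact: continuous_compose (@continuous_snd _ _) continuous_unitI_val.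
Qed.

Lemma unitI_mul0 s : unitI_mul s (unitI0 R) = unitI0 R.
Proof. by apply: unitI_inj; rewrite mk_unitIE unitI_val0 mulr0. Qed.

Lemma unitI_mul1 s : unitI_mul s (unitI1 R) = s.
Proof. by apply: unitI_inj; rewrite mk_unitIE unitI_val1 mulr1. Qed.

End unit_interval.

(** * Closedness in B * [0, 1], tested on B *)

Section products_with_the_interval.
Context {R : realType} {B : topologicalType}.
Implicit Types (F : set (B * unitI R)) (K : set (unitI R)).

Definition proj_along K F : set B := [set b | exists2 s, K s & F (b, s)].

Lemma closed_snd_eq (c : unitI R) : closed [set p : B * unitI R | p.2 = c].
Proof.
have -> : [set p : B * unitI R | p.2 = c] =
    (fun p => unitI_val p.2) @^-1` [set y | y = unitI_val c].
  by apply/seteqP; split => p /= => [->//|/unitI_inj ->].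
apply: closed_preimage; last exact: closed_eq.
exact: continuous_compose (@continuous_snd _ _) continuous_unitI_val.
Qed.

Lemma closed_slice F (b : B) : closed F -> closed [set s | F (b, s)].
Proof.
move=> Fc; apply: (closed_preimage (f := fun s => (b, s))) => //.
apply: (continuous_pair (f := cst b) (g := id)); last exact: continuous_id.
exact: cst_continuous.
Qed.

(** The tube lemma for the complement: if {b} * K misses [F], then so does V * K for some
    neighbourhood V of b. *)
Lemma closed_proj_along F K : closed F -> compact K -> closed (proj_along K F).
Proof.
move=> /closed_openC Fo /compact_near_coveringP Kc; rewrite -openC openE => b nb.
have := Kc B (nbhs b) (fun b' s => ~ F (b', s)).
have H s : K s -> \forall s' \near s & b' \near b, ~ F (b', s').
  move=> Ks; have : (~` F) (b, s) by move=> Fbs; apply: nb; exists s.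
  move: Fo; rewrite openE => /[apply] -[[P Q] [/= Pb Qs] PQ].
  exists (Q, P) => // -[s' b'] /= [Qs' Pb']; exact: (PQ (b', s')).
move=> /(_ _ H); rewrite /interior; apply: filterS => b' h [s Ks Fs].
exact: h Fs.
Qed.

(* The fibres of the complement of F are open, so a point (b, s) outside F has
   a compact neighbourhood K of s with {b} * K outside F. *)
Lemma closed_prod_unitI F :
  (forall b, closed [set s | F (b, s)]) ->
  (forall K, compact K -> closed (proj_along K F)) -> closed F.
Proof.
move=> Fs Fp; rewrite -openC openE => -[b s] nF.
have [e /= e0 eF] : exists2 e : R, 0 < e &
    forall t : unitI R, `|unitI_val s - unitI_val t| < e -> ~ F (b, t).
  have := Fs b; rewrite -openC => -[W Wo WE].
  have : W (unitI_val s) by have : (~` [set t | F (b, t)]) s by []; rewrite -WE.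
  move: Wo; rewrite openE => /[apply] -[e /= e0 eW]; exists e => // t st Ft.
  have : (~` [set t | F (b, t)]) t by rewrite -WE; apply: eW.
  exact.
pose K := [set t : unitI R | `|unitI_val s - unitI_val t| <= e / 2].
have Kc : compact K.
  apply: (@subclosed_compact _ _ setT) => //; last exact: unitI_compact.
  rewrite (_ : K = (fun t : unitI R => `|unitI_val s - unitI_val t|) @^-1` [set x | x <= e / 2]) //.
  apply: closed_preimage; last exact: closed_le.
  apply: (continuous_compose (f := fun t => unitI_val s - unitI_val t)).
    by apply: continuous_subr; [exact: continuous_cst|exact: continuous_unitI_val].
  exact: norm_continuous.
have nb : (~` proj_along K F) b.
  by move=> [t Kt]; apply: eF; apply: le_lt_trans Kt _; lra.
have := Fp K Kc; rewrite -openC openE => /(_ b nb) VF.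
exists (~` proj_along K F, [set t | K t]) => /=; last first.
  by move=> [b' t] /= [Vb' Kt] F'; apply: Vb'; exists t.
split => //.
apply: (continuous_unitI_val (t := [set x | `|unitI_val s - x| <= e / 2])).
by exists (e / 2) => /=; [lra|move=> x /= /ltW].
Qed.

End products_with_the_interval.

(** * Globes and globular spheres *)

Section globe_points.
Context {R : realType} {Z : topologicalType}.
Implicit Types (z : Z) (t s : unitI R) (u v : glob R Z).

Definition gpt z t : glob R Z := \pi_(glob R Z) (z, t).

Lemma gptP z t z' t' : gpt z t = gpt z' t' <->
  t = t' /\ (z = z' \/ t = unitI0 R \/ t = unitI1 R).
Proof.
split.
  move=> /eqmodP /= /predU1P[[-> ->]|/andP[/eqP /= -> /orP[/eqP ->|/eqP ->]]].
  - by split => //; left.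
  - by split => //; right; left.
  - by split => //; right; right.
move=> [->] h; apply/eqmodP => /=.
case: h => [->|h]; first by rewrite eqxx.
by apply/orP; right; rewrite eqxx /=; case: h => ->; rewrite eqxx ?orbT.
Qed.

Lemma gptE u : u = gpt (repr u).1 (repr u).2.
Proof. by rewrite /gpt -surjective_pairing reprK. Qed.

Lemma glob_ind (P : glob R Z -> Prop) : (forall z t, P (gpt z t)) -> forall u, P u.
Proof. by move=> H u; rewrite (gptE u). Qed.

Lemma continuous_gpt : continuous (fun x : Z * unitI R => gpt x.1 x.2).
Proof.
have -> : (fun x : Z * unitI R => gpt x.1 x.2) = \pi_(glob R Z).
  by apply/funext => -[].
exact: pi_continuous.
Qed.

Lemma continuous_gpt_comp (T : topologicalType) (f : T -> Z) (g : T -> unitI R) :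
  continuous f -> continuous g -> continuous (fun x => gpt (f x) (g x)).
Proof. by move=> fc gc; exact: continuous_compose (continuous_pair fc gc) continuous_gpt. Qed.

Lemma closed_glob (F : set (glob R Z)) :
  closed [set x : Z * unitI R | F (gpt x.1 x.2)] -> closed F.
Proof.
rewrite -openC -[in X in _ -> X]openC => h.
rewrite /open /= /quotient_open; congr (open _): h.
by apply/funext => -[].
Qed.

Lemma continuous_glob (T : topologicalType) (f : glob R Z -> T) :
  continuous (fun x : Z * unitI R => f (gpt x.1 x.2)) -> continuous f.
Proof.
move=> fc; apply/continuous_closedP => C Cc; apply: closed_glob.
exact: (closed_preimage fc Cc).
Qed.

(** By [closed_prod_unitI] only slices and subsets of Glob(Z) matter. The latter are tested on Z *
    [0, 1], and projecting along [K] commutes with this pullback. *)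
Lemma closed_glob_prod (F : set (glob R Z * unitI R)) :
  closed [set x : Z * unitI R * unitI R | F (gpt x.1.1 x.1.2, x.2)] -> closed F.
Proof.
move=> Fc; apply: closed_prod_unitI.
  by elim/glob_ind => z t; exact: closed_slice (z, t) Fc.
move=> K Kc; apply: closed_glob.
exact: closed_proj_along Fc Kc.
Qed.

Definition height u : unitI R := (repr u).2.

Lemma heightE z t : height (gpt z t) = t.
Proof. by have /gptP[] := gptE (gpt z t). Qed.

Lemma continuous_height : continuous height.
Proof.
apply: continuous_glob; under eq_fun do rewrite heightE.
exact: continuous_snd.
Qed.

Lemma glob_le_gpt z t t' : (t : R) <= (t' : R) -> glob_le (gpt z t) (gpt z t').
Proof. by move=> tt'; exists z, t, t'. Qed.

Lemma glob_le_height u v : glob_le u v -> (height u : R) <= (height v : R).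
Proof.
by move=> [z [t [t' [tt' -> ->]]]]; rewrite -/(gpt z t) -/(gpt z t') !heightE.
Qed.

(* Only points of equal base are comparable, except at the two poles. *)
Lemma directed_fibre (delta : unitI R -> glob R Z) :
  continuous delta ->
  (forall s s', (s : R) <= (s' : R) -> glob_le (delta s) (delta s')) ->
  exists z (tau : unitI R -> unitI R),
    [/\ continuous tau,
        forall s s', (s : R) <= (s' : R) -> (tau s : R) <= (tau s' : R) &
        forall s, delta s = gpt z (tau s)].
Proof.
move=> dc dm.
suff [z zP] : exists z, forall s, delta s = gpt z (height (delta s)).
  exists z, (height \o delta); split => //.
    exact: continuous_compose dc continuous_height.
  by move=> s s' /dm /glob_le_height.
(* Strictly between the poles the base is unique, and every other point of the path is comparable
   with such a point, so that base serves for it too. A path without such a point only takes the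
   poles, where any base serves. *)
have [[s0 [n0 n1]]|N] := pselect (exists s0,
    height (delta s0) <> unitI0 R /\ height (delta s0) <> unitI1 R).
  exists (repr (delta s0)).1 => s.
  have key z t : delta s0 = gpt z t -> z = (repr (delta s0)).1.
    move=> E; have := gptE (delta s0); rewrite {1}E => /gptP [_ [//|e]].
    by move: n0 n1; rewrite E heightE; case: e.
  have [/dm|/ltW /dm] := leP (s : R) (s0 : R).
    move=> [z [t [t' [_ -> E]]]].
    by rewrite (key z t')// -/(gpt z t) heightE.
  move=> [z [t [t' [_ E ->]]]].
  by rewrite (key z t)// -/(gpt z t') heightE.
exists (repr (delta (unitI0 R))).1 => s; rewrite [LHS]gptE; apply/gptP; split => //.
right; apply: contrapT => /not_orP h; apply: N; exists s; exact: h.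
Qed.

End globe_points.

Section globe_maps.
Context {R : realType} {Z Z' : topologicalType} (f : Z -> Z').

Lemma glob_mapE z (t : unitI R) : glob_map f (gpt z t) = gpt (f z) t.
Proof.
rewrite /glob_map -/(gpt _ _); apply/gptP.
have /gptP[<- [<-|h]] := gptE (gpt z t); split => //; [by left|by right].
Qed.

Lemma continuous_glob_map : continuous f -> continuous (glob_map (R := R) f).
Proof.
move=> fc; apply: continuous_glob; under eq_fun do rewrite glob_mapE.
apply: continuous_gpt_comp; last exact: continuous_snd.
exact: continuous_compose (@continuous_fst _ _) fc.
Qed.

Lemma glob_le_map (u v : glob R Z) :
  glob_le u v -> glob_le (glob_map f u) (glob_map f v).
Proof.
move=> [z [t [t' [tt' -> ->]]]].
by rewrite -/(gpt z t) -/(gpt z t') !glob_mapE; exact: glob_le_gpt.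
Qed.

End globe_maps.

Section globular_spheres.
Context {R : realType}.

Lemma sphere_neq0 n : exists z : sphere R n.+1, True.
Proof.
have h : sphere R n.+1 (\row_j (j == ord0)%:R).
  rewrite /sphere /= (bigD1 ord0)//= mxE eqxx expr1n big1 ?addr0// => i.
  by move=> /negbTE i0; rewrite mxE i0 expr0n.
by exists (SigSub (mem_set h)).
Qed.

Lemma sphere0 (z : sphere R 0) : False.
Proof. by have := set_valP z; rewrite /sphere /= big_ord0 => /eqP; rewrite eq_sym oner_eq0. Qed.

Lemma continuous_sphere_incl n : continuous (@sphere_incl R n).
Proof.
apply: continuous_set_type.
have -> : set_val \o @sphere_incl R n = set_val by apply/funext => z; exact: set_val_mk.
exact: continuous_set_val.
Qed.

Lemma sphere_inclP n (d : disk R n) :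
  (exists z, sphere_incl z = d) <-> sphere R n (set_val d).
Proof.
split; first by move=> [z <-]; rewrite set_val_mk; exact: set_valP.
move=> h; exists (SigSub (mem_set h)); by apply: val_inj.
Qed.

Lemma gsphere_incl_pole n (d : disk R n) t : t = unitI0 R \/ t = unitI1 R ->
  exists2 u : gsphere R n, gsphere_incl u = gpt d t &
    gsphere_iota u \/ gsphere_sigma u.
Proof.
case: n d => [|n] d te.
  case: te => ->; [exists false|exists true]; try by [left|right].
    by apply/gptP; split => //; right; left.
  by apply/gptP; split => //; right; right.
have [z _] := sphere_neq0 n.
exists (gpt z t); first by rewrite /= glob_mapE; apply/gptP; split => //; right.
by case: te => ->; [left|right]; exists z.
Qed.

Lemma gsphere_incl_polar n (u : gsphere R n) :
  gsphere_iota u \/ gsphere_sigma u ->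
  exists d t, gsphere_incl u = gpt d t /\ (t = unitI0 R \/ t = unitI1 R).
Proof.
case: n u => [|n] u /=.
  by move=> _; exists (disk0 R 0); eexists; split; [reflexivity|case: u; [right|left]].
by case=> -[z _ <-]; rewrite -/(gpt _ _) glob_mapE; eexists _, _; split; eauto.
Qed.

Lemma gsphere_incl_range n (d : disk R n) t :
  range (@gsphere_incl R n) (gpt d t) <->
  sphere R n (set_val d) \/ t = unitI0 R \/ t = unitI1 R.
Proof.
split; last first.
  move=> [|te]; last by have [u uE _] := gsphere_incl_pole d te; exists u.
  case: n d => [|n] d /sphere_inclP[z zd]; first by case: (sphere0 z).
  by exists (gpt z t) => //=; rewrite glob_mapE zd.
case: n d => [|n] d [u _ /=].
  move=> /gptP [<- _]; right; by case: u; [right|left].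
rewrite (gptE (u : glob R _)) glob_mapE => /gptP [-> [<-|]]; last by right.
by left; apply/sphere_inclP; eexists.
Qed.

Lemma continuous_gsphere_incl n : continuous (@gsphere_incl R n).
Proof.
case: n => [|n]; last exact/continuous_glob_map/continuous_sphere_incl.
by apply/continuousP => A _; exact: discrete_open.
Qed.

Lemma continuous_sqr_norm n :
  continuous (fun x : 'rV[R]_n => \sum_i x 0 i ^+ 2).
Proof.
have := @continuous_sumr R 'rV[R]_n n (fun i x => x 0 i ^+ 2); apply => i.
by apply: continuous_mulr; exact: coord_continuous.
Qed.

(** [P] will say whether a given set contains a pole: the pole pulls back to a whole end of D^n *
    [0, 1], or to nothing. *)
Lemma closed_height_eq n (P : Prop) (c : unitI R) :
  closed [set x : disk R n * unitI R | P /\ x.2 = c].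
Proof.
have [p|np] := pselect P; last first.
  suff -> : [set x : disk R n * unitI R | P /\ x.2 = c] = set0 by exact: closed0.
  by apply/seteqP; split => // x [].
have -> : [set x : disk R n * unitI R | P /\ x.2 = c] = [set x | x.2 = c].
  by apply/seteqP; split => x // [].
exact: closed_snd_eq.
Qed.

Lemma closed_sphere_incl_prod n (G : set (sphere R n * unitI R)) :
  closed G ->
  closed [set x : disk R n * unitI R |
    exists2 z, sphere_incl z = x.1 & G (z, x.2)].
Proof.
move=> /closed_openC; rewrite openE => Go; rewrite -openC openE => -[d t] /= nG.
have [/sphere_inclP[z zd]|nd] := pselect (sphere R n (set_val d)).
  have /Go[[P Q] /= [[_ [[W Wo <-] /= Wz WP]] Qt] PQ] : (~` G) (z, t).
    by move=> Gzt; apply: nG; exists z.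
  exists (set_val @^-1` W, Q) => /=.
    split => //; apply: open_nbhs_nbhs; split; first by exists W.
    by rewrite /= -zd set_val_mk.
  move=> [d' t'] /= [Wd' Qt'] [z' zd' Gz']; apply: (PQ (z', t')) Gz'.
  split => //; apply: WP => /=; move: Wd'; rewrite -zd' /=.
  by rewrite set_val_mk.
exists (~` (set_val @^-1` sphere R n), setT) => /=.
  split; last exact: filterT.
  apply: open_nbhs_nbhs; split => //; rewrite openC.
  apply: closed_preimage; first exact: continuous_set_val.
  exact: (closed_preimage (@continuous_sqr_norm n) (@closed_eq R 1)).
move=> [d' t'] /= [nd' _] [z zd' _]; apply: nd'; rewrite -zd'.
by apply/sphere_inclP; exists z.
Qed.

(** Pulled back to D^n * [0, 1], the image is the trace of [F] over the sphere, together with a full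
    end for each pole in [F]. This is what makes lower skeleta closed in a complex. *)
Lemma closed_gsphere_incl n (F : set (gsphere R n)) :
  closed F -> closed (@gsphere_incl R n @` F).
Proof.
case: n F => [|n] F Fc; apply: closed_glob.
  rewrite (_ : [set x | _] = [set x | F false /\ x.2 = unitI0 R] `|`
      [set x | F true /\ x.2 = unitI1 R]).
    by apply: closedU; exact: closed_height_eq.
  apply/seteqP; split => [[d t] /= [b Fb /gptP[<- _]]|[d t] /= [[Fb ->]|[Fb ->]]].
  - by case: b Fb; [right|left].
  - by exists false => //; apply/gptP; split => //; right; left.
  - by exists true => //; apply/gptP; split => //; right; right.
rewrite (_ : [set x | _] =
    [set x | exists2 z, sphere_incl z = x.1 & F (gpt z x.2)] `|`
    ([set x | (exists z, F (gpt z (unitI0 R))) /\ x.2 = unitI0 R] `|`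
     [set x | (exists z, F (gpt z (unitI1 R))) /\ x.2 = unitI1 R])).
  apply: closedU; last by apply: closedU; exact: closed_height_eq.
  apply: (closed_sphere_incl_prod (G := [set x | F (gpt x.1 x.2)])).
  exact: closed_preimage continuous_gpt Fc.
apply/seteqP; split => [[d t] /= [u]|[d t] /=].
  rewrite (gptE (u : glob R _)); move: (repr _).1 (repr _).2 => z t' Fz.
  rewrite glob_mapE => /gptP[<- [zd|[te|te]]].
  - by left; exists z.
  - by right; left; split => //; exists z; rewrite -te.
  - by right; right; split => //; exists z; rewrite -te.
move=> [[z zd Fz]|[[[z Fz] ->]|[[z Fz] ->]]].
- by exists (gpt z t) => //; rewrite glob_mapE zd.
- by exists (gpt z (unitI0 R)) => //; rewrite glob_mapE; apply/gptP; split; [|right; left].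
- by exists (gpt z (unitI1 R)) => //; rewrite glob_mapE; apply/gptP; split; [|right; right].
Qed.

End globular_spheres.

(** * Disks *)

(* The substitution A = a (1 - b / 2), B = b (1 - a / 2) satisfies
   1 - A - B = (1 - a) (1 - b), so it maps the unit square to the simplex
   A + B <= 1; with a = |x|^2 and b = y^2 it underlies the homeomorphism
   (x, y) |-> (x sqrt (1 - y^2 / 2), y sqrt (1 - |x|^2 / 2)) between
   D^n * [-1, 1] and D^(n+1).  Its inverse solves a quadratic equation. *)
Section square_to_simplex.
Context {R : realType}.
Implicit Types a b A B : R.

(** Since A - B = a - b, eliminating a from B = b (1 - a / 2) gives b^2 - (2 - A + B) b + 2 B = 0,
    whose discriminant this is. The roots are b and 2 - a with b <= 1 <= 2 - a, so [simplex_root]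
    takes the smaller one. By symmetry of the discriminant, exchanging A and B gives a. *)
Let discr A B := (2 - A - B) ^+ 2 - 4 * A * B.

Definition simplex_root A B := ((2 - A + B) - Num.sqrt (discr A B)) / 2.

Let sqrt_discr A B : 0 <= A -> 0 <= B -> A + B <= 1 ->
  exists2 r, Num.sqrt (discr A B) = r &
    [/\ 0 <= r, r ^+ 2 = discr A B & Num.sqrt (discr B A) = r].
Proof.
move=> A0 B0 AB; exists (Num.sqrt (discr A B)) => //; split.
- exact: sqrtr_ge0.
- rewrite sqr_sqrtr//.
  have -> : discr A B = 4 * (1 - (A + B)) + (A - B) ^+ 2 by rewrite /discr; ring.
  by rewrite addr_ge0 ?sqr_ge0// mulr_ge0// subr_ge0.
- by congr Num.sqrt; rewrite /discr; ring.
Qed.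

Lemma simplex_root_ge0 A B : 0 <= A -> 0 <= B -> A + B <= 1 ->
  0 <= simplex_root A B.
Proof.
move=> A0 B0 AB; have [r rE [r0 rr _]] := sqrt_discr A0 B0 AB.
rewrite /simplex_root rE.
suff : r <= 2 - A + B by lra.
have h : 0 <= 2 - A + B by lra.
rewrite -(@ler_pXn2r _ 2)// rr /discr.
lra.
Qed.

Lemma simplex_root_le1 A B : 0 <= A -> 0 <= B -> A + B <= 1 ->
  simplex_root A B <= 1.
Proof.
move=> A0 B0 AB; have [r rE [r0 rr _]] := sqrt_discr A0 B0 AB.
rewrite /simplex_root rE.
suff : B - A <= r by lra.
have [|?] := leP 0 (B - A); last lra.
by move=> h; rewrite -(@ler_pXn2r _ 2)// rr /discr; lra.
Qed.

Lemma simplex_rootE A B : 0 <= A -> 0 <= B -> A + B <= 1 ->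
  simplex_root A B * (1 - simplex_root B A / 2) = B.
Proof.
move=> A0 B0 AB; have [r rE [r0 rr rE']] := sqrt_discr A0 B0 AB.
by rewrite /simplex_root rE rE'; move: rr; rewrite /discr; nra.
Qed.

Lemma simplex_root_id a b : 0 <= a <= 1 -> 0 <= b <= 1 ->
  simplex_root (a * (1 - b / 2)) (b * (1 - a / 2)) = b.
Proof.
move=> /andP[a0 a1] /andP[b0 b1]; rewrite /simplex_root.
have -> : discr (a * (1 - b / 2)) (b * (1 - a / 2)) = (2 - a - b) ^+ 2.
  by rewrite /discr; field.
rewrite sqrtr_sqr ger0_norm; last lra.
by field.
Qed.

End square_to_simplex.

(** * A homeomorphism between D^n * [0, 1] and D^(n+1) *)

Section disk_times_interval.
Context {R : realType} {n : nat}.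
Implicit Types (x : 'rV[R]_n) (v : 'rV[R]_n.+1) (d : disk R n).

Definition sqr_norm m (x : 'rV[R]_m) : R := \sum_i x 0 i ^+ 2.

Definition vhead v : R := v 0 ord0.
Definition vtail v : 'rV[R]_n := \row_j v 0 (lift ord0 j).
Definition vcons (y : R) x : 'rV[R]_n.+1 :=
  \row_i (if unlift ord0 i is Some j then x 0 j else y).

Lemma vhead_cons y x : vhead (vcons y x) = y.
Proof. by rewrite /vhead mxE unlift_none. Qed.

Lemma vtail_cons y x : vtail (vcons y x) = x.
Proof. by apply/rowP => j; rewrite !mxE liftK. Qed.

Lemma vconsE v : vcons (vhead v) (vtail v) = v.
Proof. by apply/rowP => i; rewrite mxE; case: unliftP => [j|] ->; rewrite ?mxE. Qed.

Lemma sqr_norm_ge0 m (x : 'rV[R]_m) : 0 <= sqr_norm x.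
Proof. by apply: sumr_ge0 => i _; exact: sqr_ge0. Qed.

Lemma sqr_normZ m (c : R) (x : 'rV[R]_m) : sqr_norm (c *: x) = c ^+ 2 * sqr_norm x.
Proof. by rewrite /sqr_norm mulr_sumr; apply: eq_bigr => i _; rewrite mxE exprMn. Qed.

Lemma sqr_norm_split v : sqr_norm v = sqr_norm (vtail v) + vhead v ^+ 2.
Proof.
rewrite /sqr_norm big_ord_recl addrC; congr (_ + _).
by apply: eq_bigr => i _; rewrite mxE.
Qed.

Lemma disk_norm m (d : disk R m) : 0 <= sqr_norm (set_val d) <= 1.
Proof. by rewrite sqr_norm_ge0; exact: (set_valP d). Qed.

Definition signed (s : unitI R) : R := 2 * (s : R) - 1.

Lemma signed_sqr (s : unitI R) : 0 <= signed s ^+ 2 <= 1.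
Proof.
by have := unitI_ge0 s; have := unitI_le1 s; rewrite sqr_ge0 /signed /=; nra.
Qed.

(** Positive on [0, 1], so the scaling factors never vanish and the inverse map may divide by
    them. *)
Let half (c : R) := 1 - c / 2.

Let half_gt0 c : 0 <= c <= 1 -> 0 < half c.
Proof. by rewrite /half => /andP[? ?]; lra. Qed.

Definition cyl_vec (d : disk R n) (s : unitI R) : 'rV[R]_n.+1 :=
  vcons (signed s * Num.sqrt (half (sqr_norm (set_val d))))
        (Num.sqrt (half (signed s ^+ 2)) *: set_val d).

Lemma cyl_vec_tail d s : sqr_norm (vtail (cyl_vec d s)) =
  sqr_norm (set_val d) * half (signed s ^+ 2).
Proof.
rewrite vtail_cons sqr_normZ sqr_sqrtr; first exact: mulrC.
exact/ltW/half_gt0/signed_sqr.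
Qed.

Lemma cyl_vec_head d s : vhead (cyl_vec d s) ^+ 2 =
  signed s ^+ 2 * half (sqr_norm (set_val d)).
Proof.
rewrite vhead_cons exprMn sqr_sqrtr//.
exact/ltW/half_gt0/disk_norm.
Qed.

(** This form shows that the norm is 1 exactly when |d| = 1 or s is 0 or 1, that is, on the boundary
    of the product. *)
Lemma cyl_vec_norm d s : sqr_norm (cyl_vec d s) =
  1 - (1 - sqr_norm (set_val d)) * (1 - signed s ^+ 2).
Proof. by rewrite sqr_norm_split cyl_vec_tail cyl_vec_head /half; field. Qed.

Lemma cyl_vec_disk d s : disk R n.+1 (cyl_vec d s).
Proof.
rewrite /disk /= -/(sqr_norm _) cyl_vec_norm.
have := disk_norm d; have := signed_sqr s.
move: (sqr_norm _) (_ ^+ 2) => a b /andP[b0 b1] /andP[a0 a1].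
by rewrite gerBl mulr_ge0 ?subr_ge0.
Qed.

Definition cyl_disk d s : disk R n.+1 := SigSub (mem_set (cyl_vec_disk d s)).

Lemma cyl_diskE d s : set_val (cyl_disk d s) = cyl_vec d s.
Proof. exact: set_val_mk. Qed.

Section inverse.
Variable e : disk R n.+1.
Let v := set_val e.
Let A := sqr_norm (vtail v).
Let B := vhead v ^+ 2.
Let b := simplex_root A B.
Let a := simplex_root B A.

Let A0 : 0 <= A. Proof. exact: sqr_norm_ge0. Qed.
Let B0 : 0 <= B. Proof. exact: sqr_ge0. Qed.
Let AB : A + B <= 1.
Proof. by rewrite -sqr_norm_split; case/andP: (disk_norm e). Qed.
Let BA : B + A <= 1. Proof. by rewrite addrC. Qed.
Let a01 : 0 <= a <= 1. Proof. by rewrite simplex_root_ge0 ?simplex_root_le1. Qed.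
Let b01 : 0 <= b <= 1. Proof. by rewrite simplex_root_ge0 ?simplex_root_le1. Qed.

Definition base_vec : 'rV[R]_n := (Num.sqrt (half b))^-1 *: vtail v.
Definition base_time : R := (vhead v / Num.sqrt (half a) + 1) / 2.

Lemma base_vec_norm : sqr_norm base_vec = a.
Proof.
rewrite sqr_normZ exprVn sqr_sqrtr; last exact/ltW/half_gt0.
rewrite -/A -(simplex_rootE B0 A0 BA) -/a -/b -/(half b).
by rewrite mulrC mulfK// gt_eqF// half_gt0.
Qed.

Lemma base_time_sqr : (vhead v / Num.sqrt (half a)) ^+ 2 = b.
Proof.
rewrite exprMn exprVn sqr_sqrtr; last exact/ltW/half_gt0.
rewrite -/B -(simplex_rootE A0 B0 AB) -/a -/b -/(half a).
by rewrite mulfK// gt_eqF// half_gt0.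
Qed.

Lemma base_vec_disk : disk R n base_vec.
Proof. by rewrite /disk /= -/(sqr_norm _) base_vec_norm; case/andP: a01. Qed.

Lemma base_time01 : 0 <= base_time <= 1.
Proof.
rewrite /base_time; have := b01; rewrite -base_time_sqr; move: (_ / _) => y.
by move=> /andP[_ y1]; apply/andP; split; nra.
Qed.

Definition disk_base : disk R n := SigSub (mem_set base_vec_disk).
Definition disk_time : unitI R := mk_unitI base_time01.

Lemma signed_disk_time : signed disk_time = vhead v / Num.sqrt (half a).
Proof. by rewrite /signed mk_unitIE /base_time; move: (_ / Num.sqrt _) => y; field. Qed.

Lemma disk_baseK : cyl_disk disk_base disk_time = e.
Proof.
apply: val_inj; rewrite -set_valE cyl_diskE /cyl_vec signed_disk_time.
rewrite base_time_sqr set_val_mk base_vec_norm -[RHS]vconsE; congr vcons.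
  by rewrite divfK// sqrtr_eq0 -ltNge half_gt0.
by rewrite scalerA divff ?scale1r// sqrtr_eq0 -ltNge half_gt0.
Qed.

End inverse.

Lemma cyl_disk_base d s : disk_base (cyl_disk d s) = d.
Proof.
apply: val_inj; rewrite -!set_valE set_val_mk /base_vec cyl_diskE.
rewrite cyl_vec_tail cyl_vec_head simplex_root_id ?disk_norm ?signed_sqr//.
rewrite vtail_cons scalerA mulVf ?scale1r// sqrtr_eq0 -ltNge.
exact/half_gt0/signed_sqr.
Qed.

Lemma cyl_disk_time d s : disk_time (cyl_disk d s) = s.
Proof.
apply: unitI_inj; rewrite mk_unitIE /base_time cyl_diskE.
rewrite cyl_vec_tail cyl_vec_head simplex_root_id ?disk_norm ?signed_sqr//.
rewrite vhead_cons mulfK; first by rewrite /signed; field.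
by rewrite sqrtr_eq0 -ltNge; exact/half_gt0/disk_norm.
Qed.

Lemma cyl_disk_sphere d s : sphere R n.+1 (set_val (cyl_disk d s)) <->
  sphere R n (set_val d) \/ s = unitI0 R \/ s = unitI1 R.
Proof.
rewrite cyl_diskE /sphere /= -/(sqr_norm _) -/(sqr_norm _) cyl_vec_norm.
have sE : (1 - signed s ^+ 2 == 0) = (s == unitI0 R) || (s == unitI1 R).
  have -> : 1 - signed s ^+ 2 = 4 * (s : R) * (1 - (s : R)).
    by rewrite /signed; ring.
  rewrite !mulf_eq0 pnatr_eq0 /= subr_eq0.
  by rewrite -!(inj_eq unitI_inj) unitI_val0 unitI_val1 (eq_sym _ 1).
split.
  move=> /eqP; rewrite -subr_eq0 addrAC subrr add0r oppr_eq0 mulf_eq0 sE.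
  by rewrite subr_eq0 => /orP[/eqP <-|/orP[/eqP|/eqP]]; auto.
move=> h; apply/eqP; rewrite -subr_eq0 addrAC subrr add0r oppr_eq0 mulf_eq0 sE.
by case: h => [->|[]->]; rewrite ?subrr ?eqxx ?orbT.
Qed.

Section continuity.
Context {T : topologicalType}.
Implicit Types f g : T -> R.

Lemma continuous_half f : continuous f -> continuous (fun p => half (f p)).
Proof.
move=> fc; apply: continuous_subr; first exact: continuous_cst.
by apply: continuous_mulr; [exact: fc|exact: continuous_cst].
Qed.

Lemma continuous_sqr f : continuous f -> continuous (fun p => f p ^+ 2).
Proof. by move=> fc; apply: continuous_mulr. Qed.

Lemma continuous_simplex_root f g :
  continuous f -> continuous g -> continuous (fun p => simplex_root (f p) (g p)).
Proof.
move=> fc gc; apply: continuous_mulr; last exact: continuous_cst.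
apply: continuous_subr.
  by apply: continuous_addr gc; apply: continuous_subr fc; exact: continuous_cst.
apply: continuous_sqrtr; apply: continuous_subr.
  apply: continuous_sqr; apply: continuous_subr gc.
  by apply: continuous_subr fc; exact: continuous_cst.
apply: continuous_mulr gc; apply: continuous_mulr fc.
exact: continuous_cst.
Qed.

Lemma continuous_coord m (h : T -> 'rV[R]_m) i :
  continuous h -> continuous (fun p => h p 0 i).
Proof.
move=> hc; apply: (continuous_compose hc (g := fun y : 'rV[R]_m => y 0 i)).
exact: coord_continuous.
Qed.

Lemma continuous_sqr_norm_comp m (h : T -> 'rV[R]_m) :
  continuous h -> continuous (fun p => sqr_norm (h p)).
Proof. by move=> hc; exact: continuous_compose hc (@continuous_sqr_norm R m). Qed.

Lemma continuous_vcons f (h : T -> 'rV[R]_n) :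
  continuous f -> continuous h -> continuous (fun p => vcons (f p) (h p)).
Proof.
move=> fc hc; apply: continuous_rV => i; under eq_fun do rewrite mxE.
by case: (unlift _ _) => [j|]; [exact: continuous_coord|].
Qed.

Lemma continuous_scaler m f (h : T -> 'rV[R]_m) :
  continuous f -> continuous h -> continuous (fun p => f p *: h p).
Proof.
move=> fc hc; apply: continuous_rV => i; under eq_fun do rewrite mxE.
by apply: continuous_mulr fc _; exact: continuous_coord.
Qed.

Lemma continuous_cyl_disk (d : T -> disk R n) (s : T -> unitI R) :
  continuous d -> continuous s -> continuous (fun p => cyl_disk (d p) (s p)).
Proof.
move=> dc sc; apply: continuous_set_type.
have dvc : continuous (fun p => set_val (d p)).
  exact: continuous_compose dc (@continuous_set_val _ _).
have ssc : continuous (fun p => signed (s p)).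
  apply: continuous_subr; last exact: continuous_cst.
  apply: continuous_mulr; first exact: continuous_cst.
  exact: continuous_compose sc continuous_unitI_val.
rewrite (_ : set_val \o _ = fun p => cyl_vec (d p) (s p)); last first.
  by apply/funext => x; exact: cyl_diskE.
apply: continuous_vcons.
  apply: continuous_mulr ssc _.
  exact/continuous_sqrtr/continuous_half/continuous_sqr_norm_comp.
apply: continuous_scaler dvc.
exact/continuous_sqrtr/continuous_half/continuous_sqr.
Qed.

End continuity.

Let vtail_val (e : disk R n.+1) := vtail (set_val e).
Let vhead_val (e : disk R n.+1) := vhead (set_val e).

Let continuous_vhead : continuous vhead_val.
Proof. exact: continuous_coord (@continuous_set_val _ _). Qed.

Let continuous_vtail : continuous vtail_val.
Proof.
apply: continuous_rV => i; under eq_fun do rewrite mxE.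
exact: continuous_coord (@continuous_set_val _ _).
Qed.

Let continuous_root1 : continuous (fun e : disk R n.+1 =>
  Num.sqrt (half (simplex_root (sqr_norm (vtail_val e)) (vhead_val e ^+ 2)))).
Proof.
apply/continuous_sqrtr/continuous_half/continuous_simplex_root.
  exact: continuous_sqr_norm_comp.
exact: continuous_sqr.
Qed.

Let continuous_root2 : continuous (fun e : disk R n.+1 =>
  Num.sqrt (half (simplex_root (vhead_val e ^+ 2) (sqr_norm (vtail_val e))))).
Proof.
apply/continuous_sqrtr/continuous_half/continuous_simplex_root.
  exact: continuous_sqr.
exact: continuous_sqr_norm_comp.
Qed.

Let root_neq0 (e : disk R n.+1) :
  Num.sqrt (half (simplex_root (sqr_norm (vtail_val e)) (vhead_val e ^+ 2))) != 0 /\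
  Num.sqrt (half (simplex_root (vhead_val e ^+ 2) (sqr_norm (vtail_val e)))) != 0.
Proof.
have AB : sqr_norm (vtail_val e) + vhead_val e ^+ 2 <= 1.
  by rewrite -sqr_norm_split; case/andP: (disk_norm e).
have h A B : 0 <= A -> 0 <= B -> A + B <= 1 ->
    Num.sqrt (half (simplex_root A B)) != 0.
  move=> A0 B0 AB'; rewrite sqrtr_eq0 -ltNge half_gt0//.
  by rewrite simplex_root_ge0 ?simplex_root_le1.
by split; apply: h; rewrite ?sqr_norm_ge0 ?sqr_ge0// addrC.
Qed.

Lemma continuous_disk_base : continuous disk_base.
Proof.
apply: continuous_set_type.
rewrite (_ : set_val \o _ = base_vec); last by apply/funext => e; exact: set_val_mk.
apply: continuous_scaler continuous_vtail.
by apply: continuous_invr continuous_root1 _ => e; case: (root_neq0 e).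
Qed.

Lemma continuous_disk_time : continuous disk_time.
Proof.
apply: continuous_unitI; under eq_fun do rewrite mk_unitIE.
apply: continuous_mulr; last exact: continuous_cst.
apply: continuous_addr; last exact: continuous_cst.
apply: continuous_mulr continuous_vhead _.
by apply: continuous_invr continuous_root2 _ => e; case: (root_neq0 e).
Qed.

End disk_times_interval.

(** * Cells and skeleta *)

Section attaching_theory.
Context {X : topologicalType} {A : set X} {S D : topologicalType}
  {j : S -> D} {C : Type} {phi : C -> S -> A} {Phi : C -> D -> X}.

Let base (u : A + C * D) : Prop :=
  match u with inl _ => True | inr (_, d) => range j d end.

Let glue_base u v : clos_refl_sym_trans _ (glue j phi) u v ->
  u = v \/ (base u /\ base v).
Proof.
elim=> {u v}.
- by move=> _ _ [c s]; right; split => //; exists s.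
- by left.
- by move=> u v _ [->|[? ?]]; [left|right].
- move=> u v w _ [->|[? ?]] _ [<-|[? ?]]; by [left|right].
Qed.

(** The generated equivalence only moves points of A and of cell boundaries, and each of these is
    glued to a point of A with the same value. Hence the condition on the kernel splits into
    conditions checked on one or two cells. *)
Lemma attaching_kernelP :
  (forall u v, attaching_map (A := A) Phi u = attaching_map Phi v <->
    clos_refl_sym_trans _ (glue j phi) u v) <->
  [/\ forall c s, Phi c (j s) = set_val (phi c s),
      forall c d, A (Phi c d) -> range j d &
      forall c d c' d', Phi c d = Phi c' d' ->
        ~ range j d -> ~ range j d' -> (c, d) = (c', d')].
Proof.
split=> [K|[K1 K2 K3]].
  split.
  - move=> c s.
    exact: esym ((K (inl (phi c s)) (inr (c, j s))).2 (rst_step _ _ _ _ (Glue _ _ _ _))).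
  - move=> c d Ad; have : attaching_map (A := A) Phi (inr (c, d)) =
      attaching_map (A := A) Phi (inl (SigSub (mem_set Ad) : A)) by rewrite /= set_val_mk.
    by move=> /K /glue_base[//|[]].
  - move=> c d c' d' E nd nd'.
    have : attaching_map (A := A) Phi (inr (c, d)) =
      attaching_map (A := A) Phi (inr (c', d')) by [].
    by move=> /K /glue_base[[-> ->]//|[]].
have step c s : clos_refl_sym_trans _ (glue j phi) (inl (phi c s)) (inr (c, j s)).
  exact: rst_step.
have norm u : base u -> exists2 a : A, attaching_map Phi u = set_val a &
    clos_refl_sym_trans _ (glue j phi) (inl a) u.
  case: u => [a _|[c _] [s _ <-]]; first by exists a => //; exact: rst_refl.
  by exists (phi c s); [exact: K1|exact: step].
move=> u v; split; last first.
  elim=> {u v}.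
  - by move=> _ _ [c s] /=; rewrite K1.
  - by [].
  - by move=> u v _ ->.
  - by move=> u v w _ -> _ ->.
have base' u' v' : attaching_map Phi u' = attaching_map Phi v' -> base u' -> base v'.
  move=> E /norm[a aE _]; case: v' E => [//|[c d]] /= E.
  by apply: (K2 c d); rewrite -E aE; exact: set_valP.
move=> E; have [bu|nbu] := pselect (base u).
  have [a aE ua] := norm _ bu; have [a' aE' va] := norm _ (base' _ _ E bu).
  have aa' : a = a' by apply: val_inj; rewrite -!set_valE -aE -aE'.
  by apply: rst_trans va; rewrite -aa'; exact: rst_sym.
have nbv : ~ base v by move=> bv; apply: nbu; exact: base' (esym E) bv.
case: u E nbu => [a _ []//|[c d]]; case: v nbv => [a []//|[c' d']] /= nd' E nd.
by rewrite (K3 _ _ _ _ E nd nd'); exact: rst_refl.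
Qed.

End attaching_theory.

Section set_type_topology.
Context {X : topologicalType}.
Implicit Types A U : set X.

(** For closed A, a relatively open subset is encoded by its complement in A, a closed set of the
    ambient space, to which the criteria for products apply. *)
Lemma closed_setD_of_open A U : closed A ->
  open (set_val @^-1` U : set A) -> closed (A `\` U).
Proof.
move=> Ac [V Vo E].
suff -> : A `\` U = A `&` ~` V by apply: closedI => //; exact: open_closedC.
apply/seteqP; split => x [Ax nx]; split => // h; apply: nx.
  have : (set_val @^-1` V : set A) (SigSub (mem_set Ax)) by [].
  by rewrite E.
have : (set_val @^-1` U : set A) (SigSub (mem_set Ax)) by [].
by rewrite -E.
Qed.

Lemma open_of_closed_setD A U : closed (A `\` U) -> open (set_val @^-1` U : set A).
Proof.
move=> /closed_openC Fo; exists (~` (A `\` U)) => //.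
apply/seteqP; split => x /=; last by move=> Ux [].
by move=> h; apply: contrapT => nU; apply: h; split => //; exact: set_valP.
Qed.

End set_type_topology.

Section globular_complexes.
Context {R : realType} (X : globCW R).

Let kernel n := (@attaching_kernelP _ _ _ _ _ _ _ _).1
  (attaching_kernel (skelS_attaching X n)).

Lemma chr_att n (c : cell X n) u : chr c (gsphere_incl u) = set_val (att c u).
Proof. by case: (kernel n) => ->. Qed.

Lemma chr_skel_range n (c : cell X n) d :
  skel X n (chr c d) -> range (@gsphere_incl R n) d.
Proof. by case: (kernel n) => _ + _; exact. Qed.

Lemma chr_inj n (c c' : cell X n) d d' : chr c d = chr c' d' ->
  ~ range (@gsphere_incl R n) d -> ~ range (@gsphere_incl R n) d' ->
  (c, d) = (c', d').
Proof. by case: (kernel n) => _ _; exact. Qed.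

Lemma skelS n x : skel X n.+1 x <->
  skel X n x \/ exists (c : cell X n) d, x = chr c d.
Proof.
rewrite -(attaching_range (skelS_attaching X n)); split.
  move=> [[a|[c d]] _ <-] /=; first by left; exact: set_valP.
  by right; exists c, d.
move=> [xn|[c [d ->]]]; last by exists (inr (c, d)).
by exists (inl (SigSub (mem_set xn))) => //=; exact: set_val_mk.
Qed.

Lemma chr_skelS n (c : cell X n) d : skel X n.+1 (chr c d).
Proof. by apply/skelS; right; exists c, d. Qed.

Lemma skel_le m n x : (m <= n)%N -> skel X m x -> skel X n x.
Proof.
move=> /subnKC <-; elim: (n - m)%N => [|k IHk]; rewrite ?addn0// addnS.
by move=> /IHk xk; apply/skelS; left.
Qed.

Lemma skel_ex x : exists n, skel X n x.
Proof.
have : (\bigcup_n skel X n) x by rewrite skel_exhaustive.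
by move=> [n _ xn]; exists n.
Qed.

Lemma chr_pole n (c : cell X n) d t : t = unitI0 R \/ t = unitI1 R ->
  skel X 0 (chr c (gpt d t)).
Proof.
by move=> /(gsphere_incl_pole d)[u <- ue]; rewrite chr_att; exact: att_ends.
Qed.

Lemma continuous_chr n (c : cell X n) : continuous (chr c).
Proof.
apply/continuousP => U Uo.
have : open (set_val @^-1` U : set (skel X n.+1)).
  by move/continuousP: (@continuous_set_val _ (skel X n.+1)); exact.
by move=> /(attaching_topology (skelS_attaching X n))[].
Qed.

(** By induction over the skeleta, with an empty complement up to dimension n. In a cell of higher
    dimension, the preimage of [skel X n] lies in the boundary, where it comes from a closed set of
    the globular sphere. *)
Lemma closed_skel n : closed (skel X n).
Proof.
rewrite -openC; apply/weak_topology; elim=> [|m IHm].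
  rewrite (_ : _ @^-1` _ = set0); first exact: open0.
  apply/seteqP; split => // x; apply.
  exact: skel_le (set_valP x).
have [mn|] := leqP m.+1 n; last rewrite ltnS => nm.
  rewrite (_ : _ @^-1` _ = set0); first exact: open0.
  apply/seteqP; split => // x; apply.
  exact: skel_le (set_valP x).
apply/(attaching_topology (skelS_attaching X m)); split => // c.
have -> : chr c @^-1` (~` skel X n) =
    ~` (@gsphere_incl R m @` (att c @^-1` (set_val @^-1` skel X n))).
  congr (~` _); apply/seteqP; split => [d /= dn|d /= [u un <-]].
    have [u _ ud] := chr_skel_range (skel_le nm dn).
    by exists u => //=; rewrite -chr_att ud.
  by rewrite chr_att.
rewrite openC; apply: closed_gsphere_incl; apply: closed_preimage.
  exact: attaching_continuous (skelS_attaching X m) c.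
by rewrite -openC.
Qed.

Lemma closed_sub_skel0 (F : set X) : F `<=` skel X 0 -> closed F.
Proof.
move=> F0; have -> : F = skel X 0 `\` ~` F.
  apply/seteqP; split => x; last by move=> [_ /contrapT].
  by move=> Fx; split; [exact: F0|exact].
by apply: closed_setD_of_open; [exact: closed_skel|exact: skel0_discrete].
Qed.

Lemma closed_sub_skelS n (F : set X) : F `<=` skel X n.+1 ->
  closed (F `&` skel X n) -> (forall c : cell X n, closed (chr c @^-1` F)) ->
  closed F.
Proof.
move=> FS Fn Fc; have -> : F = skel X n.+1 `\` ~` F.
  apply/seteqP; split => x; last by move=> [_ /contrapT].
  by move=> Fx; split; [exact: FS|exact].
apply: closed_setD_of_open; first exact: closed_skel.
apply/(attaching_topology (skelS_attaching X n)); split.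
  apply: open_of_closed_setD; rewrite setDE setCK setIC; exact: Fn.
by move=> c; exact: closed_openC (Fc c).
Qed.

Lemma closed_skel_weak (F : set X) :
  (forall n, closed (F `&` skel X n)) -> closed F.
Proof.
move=> Fn; rewrite -openC; apply/weak_topology => n.
by apply: open_of_closed_setD; rewrite setDE setCK setIC; exact: Fn.
Qed.

Lemma closed_prod_sub_skel0 (F : set (X * unitI R)) :
  (forall x s, F (x, s) -> skel X 0 x) ->
  (forall x, closed [set s | F (x, s)]) -> closed F.
Proof.
move=> F0 Fs; apply: closed_prod_unitI => // K _.
by apply: closed_sub_skel0 => x [s _ /F0].
Qed.

(** Projecting along [K] commutes with restricting to a skeleton and with pulling back to a cell, so
    the projections are closed by [closed_sub_skelS]. *)
Lemma closed_prod_sub_skelS n (F : set (X * unitI R)) :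
  (forall x s, F (x, s) -> skel X n.+1 x) ->
  closed (F `&` [set p | skel X n p.1]) ->
  (forall c : cell X n, closed [set p : gdisk R n * unitI R | F (chr c p.1, p.2)]) ->
  closed F.
Proof.
move=> FS Fn Fc; apply: closed_prod_unitI => [x|K Kc].
  have [/skelS[xn|[c [d xcd]]]|nx] := pselect (skel X n.+1 x).
  - have := closed_slice (b := x) Fn; congr closed.
    by apply/seteqP; split => s /= => [[]|?].
  - by rewrite xcd; exact: (closed_slice (b := d) (Fc c)).
  - rewrite (_ : [set s | _] = set0); first exact: closed0.
    by apply/seteqP; split => // s /= /FS.
apply: (@closed_sub_skelS n) => [x [s _ /FS]//||c].
- have := closed_proj_along Fn Kc; congr closed.
  apply/seteqP; split => x; first by move=> [s Ks [/= Fxs xn]]; split => //; exists s.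
  by move=> [[s Ks Fxs] xn]; exists s.
- exact: closed_proj_along (Fc c) Kc.
Qed.

Lemma closed_prod_skel_weak (F : set (X * unitI R)) :
  (forall n, closed (F `&` [set p | skel X n p.1])) -> closed F.
Proof.
move=> Fn; apply: closed_prod_unitI => [x|K Kc].
  have [n xn] := skel_ex x; have := closed_slice (b := x) (Fn n); congr closed.
  by apply/seteqP; split => s /= => [[]|?].
apply: closed_skel_weak => n; have := closed_proj_along (Fn n) Kc; congr closed.
apply/seteqP; split => x; first by move=> [s Ks [/= Fxs xn]]; split => //; exists s.
by move=> [[s Ks Fxs] xn]; exists s.
Qed.

End globular_complexes.

(** * The cylinder of a globular CW-complex *)

(* The cylinder of a globular CW-complex X is X * [0, 1] with {x} * [0, 1]
   collapsed to (x, 0) for every x in the 0-skeleton.  Its points are recorded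
   in normal form, and cyl_pt is the quotient map. *)
Record cyl (R : realType) (X : globCW R) := Cyl {
  cyl_base : X;
  cyl_time : unitI R;
  cyl_normal : skel X 0 cyl_base -> cyl_time = unitI0 R
}.

HB.instance Definition _ (R : realType) (X : globCW R) := gen_eqMixin (cyl X).
HB.instance Definition _ (R : realType) (X : globCW R) := gen_choiceMixin (cyl X).

Section cylinder.
Context {R : realType} {X : globCW R}.
Implicit Types (x : X) (s t : unitI R) (v w : cyl X).

Lemma cyl_pt_subproof x s :
  skel X 0 x -> (if `[< skel X 0 x >] then unitI0 R else s) = unitI0 R.
Proof. by move=> /asboolP ->. Qed.

Definition cyl_pt x s : cyl X := Cyl (@cyl_pt_subproof x s).

Lemma cyl_eq v w : cyl_base v = cyl_base w -> cyl_time v = cyl_time w -> v = w.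
Proof.
case: v w => [x s xs] [y t yt] /= xy st; subst y t.
by rewrite (Prop_irrelevance xs yt).
Qed.

Lemma cyl_time_pt x s : ~ skel X 0 x -> cyl_time (cyl_pt x s) = s.
Proof. by move=> nx /=; rewrite asboolF. Qed.

Lemma cyl_ptP x s y t :
  cyl_pt x s = cyl_pt y t <-> x = y /\ (skel X 0 x \/ s = t).
Proof.
split=> [E|[-> h]].
  have xy : x = y := congr1 (@cyl_base _ _) E; split=> //.
  have [x0|nx] := pselect (skel X 0 x); [by left|right].
  by move/(congr1 (@cyl_time _ _)): E; rewrite -xy !cyl_time_pt.
by apply: cyl_eq => //=; case: asboolP h => // nx [].
Qed.

Lemma cyl_ptE v : v = cyl_pt (cyl_base v) (cyl_time v).
Proof. by apply: cyl_eq => //=; case: asboolP => // /cyl_normal. Qed.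

Definition cyl_open (U : set (cyl X)) := open [set p : X * unitI R | U (cyl_pt p.1 p.2)].

Lemma cyl_openT : cyl_open setT.
Proof. exact: openT. Qed.

Lemma cyl_openI : setI_closed cyl_open.
Proof. by move=> U V; exact: openI. Qed.

Lemma cyl_open_bigU (I : Type) (f : I -> set (cyl X)) :
  (forall i, cyl_open (f i)) -> cyl_open (\bigcup_i f i).
Proof.
move=> fo; rewrite /cyl_open.
rewrite (_ : mkset _ = \bigcup_i [set p : X * unitI R | f i (cyl_pt p.1 p.2)])//.
by apply: bigcup_open => i _; exact: fo.
Qed.

HB.instance Definition _ :=
  isOpenTopological.Build (cyl X) cyl_openT cyl_openI cyl_open_bigU.

Lemma closed_cyl (F : set (cyl X)) :
  closed [set p : X * unitI R | F (cyl_pt p.1 p.2)] -> closed F.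
Proof. by rewrite -!openC. Qed.

Lemma continuous_cyl_pt : continuous (fun p : X * unitI R => cyl_pt p.1 p.2).
Proof. by apply/continuousP => U. Qed.

Lemma continuous_cyl_pt_comp (T : topologicalType) (f : T -> X) (g : T -> unitI R) :
  continuous f -> continuous g -> continuous (fun p => cyl_pt (f p) (g p)).
Proof.
by move=> fc gc; exact: continuous_compose (continuous_pair fc gc) continuous_cyl_pt.
Qed.

Lemma continuous_cyl (T : topologicalType) (f : cyl X -> T) :
  continuous (fun p : X * unitI R => f (cyl_pt p.1 p.2)) -> continuous f.
Proof.
move=> fc; apply/continuous_closedP => C Cc; apply: closed_cyl.
exact: (closed_preimage fc Cc).
Qed.

(** Gives the continuity of homotopies defined on the cylinder. The reduction is the one used for
    globes, [cyl X] having the quotient topology. *)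
Lemma continuous_cyl_prod (T : topologicalType) (f : cyl X * unitI R -> T) :
  continuous (fun p : X * unitI R * unitI R => f (cyl_pt p.1.1 p.1.2, p.2)) ->
  continuous f.
Proof.
move=> fc; apply/continuous_closedP => C Cc.
have Fc : closed [set p : X * unitI R * unitI R | C (f (cyl_pt p.1.1 p.1.2, p.2))].
  exact: (closed_preimage fc Cc).
apply: closed_prod_unitI => [v|K Kc].
  rewrite (cyl_ptE v).
  exact: (closed_slice (b := (cyl_base v, cyl_time v)) Fc).
by apply: closed_cyl; exact: closed_proj_along Fc Kc.
Qed.

(** A prism has one dimension more than the cell below it, so the n-skeleton contains X^(n-1) *
    [0, 1], but X^n only at the two ends. For n = 0, [n.-1] is 0 and the last alternative is
    automatic, which leaves X^0. *)
Definition cyl_skel n : set (cyl X) := [set v | skel X n (cyl_base v) /\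
  [\/ cyl_time v = unitI0 R, cyl_time v = unitI1 R | skel X n.-1 (cyl_base v)]].

Lemma cyl_skel_pt n x s : cyl_skel n (cyl_pt x s) <->
  skel X n x /\ [\/ s = unitI0 R, s = unitI1 R | skel X n.-1 x].
Proof.
have [x0|nx] := pselect (skel X 0 x).
  have h m : skel X m x by exact: skel_le x0.
  by split=> [[? _]|[? _]]; split=> //; exact: Or33.
by rewrite /cyl_skel /=; case: asboolP nx.
Qed.

Lemma cyl_skelS n x s : skel X n x -> cyl_skel n.+1 (cyl_pt x s).
Proof.
by move=> xn; apply/cyl_skel_pt; split; [exact: skel_le xn|exact: Or33].
Qed.

Lemma cyl_skel_le n v : cyl_skel n v -> cyl_skel n.+1 v.
Proof.
move=> [vn h]; split; first exact: skel_le vn.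
by case: h => h; [exact: Or31|exact: Or32|exact: Or33].
Qed.

Lemma closed_cyl_skel n : closed (cyl_skel n).
Proof.
apply: closed_cyl.
pose S m := [set p : X * unitI R | skel X m p.1].
have Sc m : closed (S m) by exact: closed_preimage (@continuous_fst _ _) (@closed_skel _ X m).
have Tc c : closed [set p : X * unitI R | p.2 = c] by exact: closed_snd_eq.
rewrite (_ : mkset _ = S n `&` ([set p | p.2 = unitI0 R] `|`
    ([set p | p.2 = unitI1 R] `|` S n.-1))).
  by apply: closedI; [exact: Sc|apply: closedU; [exact: Tc|apply: closedU; [exact: Tc|exact: Sc]]].
apply/seteqP; split=> -[x s] /=.
  move=> /cyl_skel_pt[xn h]; split=> //.
  by case: h => h; [left|right; left|right; right].
move=> [xn h]; apply/cyl_skel_pt; split => //.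
by case: h => [|[]] h; [exact: Or31|exact: Or32|exact: Or33].
Qed.

Definition prism_cell (n : nat) : Type@{Topological.axioms_.u0} :=
  match n return Type@{Topological.axioms_.u0} with
  | 0%N => Empty_set
  | m.+1 => cell X m
  end.

(* The cylinder over a cell of dimension n + 1 consists of its two end faces
   and of a prism of dimension n + 2. *)
Definition cyl_cell (n : nat) : Type@{Topological.axioms_.u0} :=
  (cell X n * bool + prism_cell n)%type.

Definition end_time (b : bool) : unitI R := if b then unitI1 R else unitI0 R.

Definition chr_prism n (c : cell X n) (u : gdisk R n.+1) : cyl X :=
  cyl_pt (chr c (glob_map disk_base u)) (disk_time (repr u).1).

Definition cyl_chr n (c : cyl_cell n) : gdisk R n -> cyl X :=
  match c with
  | inl (c, b) => fun u => cyl_pt (chr c u) (end_time b)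
  | inr c => (match n return prism_cell n -> gdisk R n -> cyl X with
              | 0%N => fun c => match c with end
              | m.+1 => @chr_prism m
              end) c
  end.

(** The representative used in [chr_prism] may have a base other than [e] only at a pole, which is
    sent into the 0-skeleton, where the time is collapsed. *)
Lemma chr_prismE n (c : cell X n) e t :
  chr_prism c (gpt e t) = cyl_pt (chr c (gpt (disk_base e) t)) (disk_time e).
Proof.
apply/cyl_ptP; rewrite glob_mapE; split=> //.
have /gptP[te [<-|h]] := gptE (gpt e t); [by right|left].
exact: chr_pole.
Qed.

Lemma continuous_chr_prism n (c : cell X n) : continuous (chr_prism c).
Proof.
apply: continuous_glob; under eq_fun do rewrite chr_prismE.
apply: continuous_cyl_pt_comp.
  apply: (continuous_compose (g := chr c)); last exact: continuous_chr.
  apply: continuous_gpt_comp; last exact: continuous_snd.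
  exact: continuous_compose (@continuous_fst _ _) continuous_disk_base.
exact: continuous_compose (@continuous_fst _ _) continuous_disk_time.
Qed.

Lemma continuous_cyl_chr n (c : cyl_cell n) : continuous (cyl_chr c).
Proof.
case: c => [[c b]|c].
  by apply: continuous_cyl_pt_comp; [exact: continuous_chr|exact: cst_continuous].
by case: n c => [[]|n c]; exact: continuous_chr_prism.
Qed.

(** In a prism, a boundary point that is not a pole lies over the sphere of the base disk, hence
    over a lower skeleton of X, or has time 0 or 1, hence lies on an end face. *)
Lemma cyl_chr_sphere n (c : cyl_cell n) u : cyl_skel n (cyl_chr c (gsphere_incl u)).
Proof.
case: c => [[c b]|c].
  apply/cyl_skel_pt; rewrite chr_att; split; first exact: set_valP.
  by case: b; [exact: Or32|exact: Or31].
case: n u c => [u []|n u c].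
have : range (@gsphere_incl R n.+1) (gsphere_incl u) by exists u.
move: (gsphere_incl u) => w; rewrite (gptE w) => /gsphere_incl_range.
move: (repr w).1 (repr w).2 => e t h; rewrite /= chr_prismE; apply/cyl_skel_pt.
split; first exact: chr_skelS.
have n' : range (@gsphere_incl R n) (gpt (disk_base e) t) -> skel X n (chr c (gpt (disk_base e) t)).
  by move=> [u' _ <-]; rewrite chr_att; exact: set_valP.
case: h => [|te].
  rewrite -(disk_baseK e) => /cyl_disk_sphere[d|[s|s]].
  - by rewrite disk_baseK; apply/Or33/n'/gsphere_incl_range; left.
  - by rewrite disk_baseK; exact: Or31.
  - by rewrite disk_baseK; exact: Or32.
by apply/Or33/n'/gsphere_incl_range; right.
Qed.

Definition cyl_att n (c : cyl_cell n) (u : gsphere R n) : cyl_skel n :=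
  SigSub (mem_set (cyl_chr_sphere c u)).

Lemma cyl_attE n (c : cyl_cell n) u :
  set_val (cyl_att c u) = cyl_chr c (gsphere_incl u).
Proof. exact: set_val_mk. Qed.

Lemma continuous_cyl_att n (c : cyl_cell n) : continuous (cyl_att c).
Proof.
apply: continuous_set_type.
rewrite (_ : set_val \o _ = cyl_chr c \o @gsphere_incl R n).
  exact: continuous_compose (@continuous_gsphere_incl R n) (@continuous_cyl_chr n c).
by apply/funext => u; exact: cyl_attE.
Qed.

Lemma cyl_chr_skelS n (c : cyl_cell n) u : cyl_skel n.+1 (cyl_chr c u).
Proof.
case: c => [[c b]|c].
  apply/cyl_skel_pt; split; first exact: chr_skelS.
  by case: b; [exact: Or32|exact: Or31].
case: n u c => [u []|n u c].
by apply: cyl_skelS; exact: chr_skelS.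
Qed.

Lemma cyl_chr_range n (c : cyl_cell n) u :
  cyl_skel n (cyl_chr c u) -> range (@gsphere_incl R n) u.
Proof.
case: c => [[c b]|c].
  by move=> /cyl_skel_pt[+ _]; exact: chr_skel_range.
case: n u c => [u []|n u c].
rewrite (gptE u); move: (repr u).1 (repr u).2 => e t.
rewrite [cyl_chr _ _]chr_prismE => /cyl_skel_pt[_ h]; apply/gsphere_incl_range.
rewrite -[X in set_val X](disk_baseK e).
case: h => [s|s|/chr_skel_range h].
- by left; apply/cyl_disk_sphere; right; left.
- by left; apply/cyl_disk_sphere; right; right.
- have [d|te] := (gsphere_incl_range _ _).1 h; last by right.
  by left; apply/cyl_disk_sphere; left.
Qed.

(** An end face and a prism of the same dimension have disjoint interiors: the prism lies over the
    skeleton to which the cell below the end face is attached. *)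
Lemma cyl_chr_inj n (c c' : cyl_cell n) u u' : cyl_chr c u = cyl_chr c' u' ->
  ~ range (@gsphere_incl R n) u -> ~ range (@gsphere_incl R n) u' ->
  (c, u) = (c', u').
Proof.
case: c c' => [[c b]|c] [[c' b']|c'].
- move=> /cyl_ptP[E h] nu nu'; have [cc uu] := chr_inj E nu nu'.
  rewrite cc uu; congr (inl (_, _), _).
  case: h => [x0|]; first by case: nu; apply: chr_skel_range; exact: skel_le x0.
  by case: b b' => [] [] // => [|/esym] /esym /unitI01.
- case: n c c' u u' => [? []|n c c' u u'] /cyl_ptP[E _] nu _; exfalso.
  by apply/nu/(chr_skel_range (c := c)); rewrite E; exact: chr_skelS.
- case: n c c' u u' => [[]|n c c' u u'] /cyl_ptP[E _] _ nu; exfalso.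
  by apply/nu/(chr_skel_range (c := c')); rewrite -E; exact: chr_skelS.
case: n c c' u u' => [[]|n c c' u u'].
rewrite (gptE u) (gptE u'); move: (repr u).1 (repr u).2 (repr u').1 (repr u').2.
move=> e t e' t' + nu nu'; rewrite /= !chr_prismE => /cyl_ptP[E h].
have nr d s : ~ range (@gsphere_incl R n.+1) (gpt d s) ->
    ~ range (@gsphere_incl R n) (gpt (disk_base d) s).
  move=> nds /gsphere_incl_range h'; apply/nds/gsphere_incl_range.
  case: h' => [h'|]; [left|by right].
  by rewrite -[X in set_val X](disk_baseK d); apply/cyl_disk_sphere; left.
have [cc /gptP[tt' dd]] := chr_inj E (nr _ _ nu) (nr _ _ nu').
have ee : disk_base e = disk_base e'.
  by case: dd => // te; case: nu; apply/gsphere_incl_range; right.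
have ss : disk_time e = disk_time e'.
  case: h => // x0; case: (nr _ _ nu); apply: chr_skel_range; exact: skel_le x0.
by rewrite cc tt' -(disk_baseK e) ee ss disk_baseK.
Qed.

End cylinder.

(** Precomposing with [clip a b] replaces a map directed on [a, b] by one directed on the whole
    interval, which frees later arguments from the subspace topology. *)
Lemma directed_in_cellP (R : realType) (X : topologicalType) n
    (psi : gdisk R n -> X) (gamma : unitI R -> X) (a b : unitI R) :
  (a : R) <= (b : R) ->
  directed_in_cell psi gamma (unitI_itv a b) <->
  exists delta : unitI R -> gdisk R n,
    [/\ continuous delta,
        forall s s' : unitI R, (s : R) <= (s' : R) -> glob_le (delta s) (delta s') &
        forall s, unitI_itv a b s -> gamma s = psi (delta s)].
Proof.
move=> ab; split=> [[delta [dc dm dE]]|[delta [dc dm dE]]]; last first.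
  by exists delta; split=> //; [exact: continuous_subspaceT|move=> s s' _ _; exact: dm].
exists (delta \o clip a b); split.
- move/subspace_sigL_continuousP: dc => dc.
  rewrite (_ : _ \o _ = sigL (unitI_itv a b) delta \o
      (fun s => SigSub (mem_set (clip_itv s ab)) : unitI_itv a b)).
    apply: continuous_compose dc; apply: continuous_set_type.
    rewrite (_ : set_val \o _ = clip a b); first exact: continuous_clip.
    by apply/funext => s; exact: set_val_mk.
  by apply/funext => s; rewrite /sigL /= set_val_mk.
- by move=> s s' ss'; apply: dm; [exact: clip_itv|exact: clip_itv|exact: clip_homo].
- by move=> s abs; rewrite /= clip_id//; exact: dE.
Qed.

(** * Directedness, attaching and topology of the cells of the cylinder *)

Section cylinder_complex.
Context {R : realType} (X : globCW R).

Lemma cyl_pt_end_directed (N : set nat) (gamma : unitI R -> X) b :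
  piecewise_directed (skel X 0) (@chr R X) N gamma ->
  piecewise_directed (@cyl_skel R X 0) (@cyl_chr R X) N
    (fun s => cyl_pt (gamma s) (end_time b)).
Proof.
move=> [k [t [kt t0 tc]]]; exists k, t; split=> // [i ik|i ik].
  by apply/cyl_skel_pt; split; [exact: t0|apply/Or33/t0].
have [n [c [Nn [delta [dc dm dE]]]]] := tc _ ik.
exists n, (inl (c, b)); split=> //; exists delta; split=> // s abs.
by rewrite dE.
Qed.

Lemma chr_prism_map n (c : cell X n) r (u : gdisk R n) :
  chr_prism c (glob_map (fun d => cyl_disk d r) u) = cyl_pt (chr c u) r.
Proof.
by rewrite [in LHS](gptE u) glob_mapE chr_prismE cyl_disk_base cyl_disk_time -gptE.
Qed.

(** A path at an arbitrary constant time runs in prisms, one dimension up, whence the shift from [N]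
    to [N']. At the ends, [cyl_pt_end_directed] avoids this shift. *)
Lemma cyl_pt_directed (N N' : set nat) (gamma : unitI R -> X) r :
  (forall n, N n -> N' n.+1) ->
  piecewise_directed (skel X 0) (@chr R X) N gamma ->
  piecewise_directed (@cyl_skel R X 0) (@cyl_chr R X) N'
    (fun s => cyl_pt (gamma s) r).
Proof.
move=> NN' [k [t [kt t0 tc]]]; exists k, t; split=> // [i ik|i ik].
  by apply/cyl_skel_pt; split; [exact: t0|apply/Or33/t0].
have [n [c [Nn dir]]] := tc _ ik.
have tt : (t i : R) <= (t i.+1 : R) by case: kt => _ _ _ /(_ _ ik) /ltW.
have [delta [dc dm dE]] := (directed_in_cellP (chr c) gamma tt).1 dir.
exists n.+1, (inr c); split; first exact: NN'.
apply/(directed_in_cellP _ _ tt); exists (glob_map (fun d => cyl_disk d r) \o delta).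
split.
- apply: continuous_compose dc _; apply: continuous_glob_map.
  by apply: continuous_cyl_disk; [exact: continuous_id|exact: cst_continuous].
- by move=> s s' /dm; exact: glob_le_map.
- by move=> s /dE ->; rewrite /= chr_prism_map.
Qed.

Lemma cyl_pt_nonconstant (gamma : unitI R -> X) r :
  nonconstant gamma -> nonconstant (fun s => cyl_pt (gamma s) r).
Proof.
move=> nc [u uE]; apply: nc; exists (cyl_base u) => s.
by rewrite -(uE s).
Qed.

Lemma unitI_IVT (tau : unitI R -> unitI R) : continuous tau ->
  tau (unitI0 R) = unitI0 R -> tau (unitI1 R) = unitI1 R ->
  exists s, tau s <> unitI0 R /\ tau s <> unitI1 R.
Proof.
move=> tc t0 t1.
pose f (x : R) : R := tau (unitI_retraction x).
have fc : continuous f.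
  apply: continuous_compose continuous_unitI_val.
  exact: continuous_compose continuous_unitI_retraction tc.
have f0 : f 0 = 0.
  by rewrite /f -{1}unitI_val0 unitI_retractionK t0 unitI_val0.
have f1 : f 1 = 1.
  by rewrite /f -{1}unitI_val1 unitI_retractionK t1 unitI_val1.
have [|c _ fcE] := @IVT R f 0 1 (1 / 2) ler01 (continuous_subspaceT fc).
  by rewrite f0 f1 min_l ?max_r ?ler01//; lra.
exists (unitI_retraction c); split=> /(congr1 (@unitI_val R)).
  by rewrite unitI_val0 -/(f c) fcE; lra.
by rewrite unitI_val1 -/(f c) fcE; lra.
Qed.

(** By [directed_fibre] a directed path in the boundary of a prism stays over one point of the
    sphere, so its time is fixed and it comes from a path in X. *)
Lemma cyl_att_directed n (c : cyl_cell n) (phi : unitI R -> gsphere R n) :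
  continuous phi ->
  (forall s s' : unitI R, (s : R) <= (s' : R) -> gsphere_le (phi s) (phi s')) ->
  gsphere_iota (phi (unitI0 R)) -> gsphere_sigma (phi (unitI1 R)) ->
  piecewise_directed (@cyl_skel R X 0) (@cyl_chr R X) [set m | (m < n)%N]
    (fun s => set_val (cyl_att c (phi s))) /\
  nonconstant (fun s => set_val (cyl_att c (phi s))).
Proof.
move=> phic phim phi0 phi1.
have -> : (fun s => set_val (cyl_att c (phi s))) =
    fun s => cyl_chr c (gsphere_incl (phi s)).
  by apply/funext => s; exact: cyl_attE.
case: c => [[c b]|c] /=.
  have [dir nc] := att_directed c phic phim phi0 phi1.
  have E : (fun s => cyl_pt (chr c (gsphere_incl (phi s))) (end_time b)) =
      fun s => cyl_pt (set_val (att c (phi s))) (end_time b).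
    by apply/funext => s; rewrite chr_att.
  by rewrite E; split; [exact: cyl_pt_end_directed|exact: cyl_pt_nonconstant].
case: n c phi phic phim phi0 phi1 => [[]|n c phi phic phim phi0 phi1].
have [z [tau [tc tm tE]]] := directed_fibre phic phim.
have tau0 : tau (unitI0 R) = unitI0 R.
  by case: phi0 => z' _; rewrite -/(gpt _ _) tE => /gptP[].
have tau1 : tau (unitI1 R) = unitI1 R.
  by case: phi1 => z' _; rewrite -/(gpt _ _) tE => /gptP[].
have : sphere R n.+1 (set_val (sphere_incl z)) by apply/sphere_inclP; exists z.
rewrite -(disk_baseK (sphere_incl z)).
move Ed: (disk_base (sphere_incl z)) => d; move Er: (disk_time (sphere_incl z)) => r.
move=> /cyl_disk_sphere dr.
have E : (fun s => chr_prism c (gsphere_incl (phi s))) =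
    fun s => cyl_pt (chr c (gpt d (tau s))) r.
  by apply/funext => s; rewrite tE /= glob_mapE chr_prismE Ed Er.
rewrite E {E}.
(* If d is on the sphere, the path below runs in the boundary of the cell [c], and [att_directed]
   applies to it. For n = 0 this sphere is empty. *)
have [/sphere_inclP|nd] := pselect (sphere R n (set_val d)).
  case: n c phi phic phim phi0 phi1 z tE d Ed r Er dr
    => [|n] c phi phic phim phi0 phi1 z tE d Ed r Er dr [y yd].
    by case: (sphere0 y).
  pose psi s : gsphere R n.+1 := gpt y (tau s).
  have [] := @att_directed _ X _ c psi.
  - by apply: continuous_gpt_comp tc; exact: cst_continuous.
  - by move=> s s' /tm; exact: glob_le_gpt.
  - by exists y => //; rewrite /psi tau0.
  - by exists y => //; rewrite /psi tau1.
  move=> dir nc.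
  have -> : (fun s => cyl_pt (chr c (gpt d (tau s))) r) =
      fun s => cyl_pt (set_val (att c (psi s))) r.
    by apply/funext => s; rewrite -chr_att /= glob_mapE yd.
  split; last exact: cyl_pt_nonconstant.
  exact: cyl_pt_directed dir.
(* With d interior, the time r is an end, and the whole path is one piece in the end face over
   [c]. *)
have [b rb] : exists b, r = end_time b.
  by case: dr => [//|[->|->]]; [exists false|exists true].
split.
  rewrite rb; apply: cyl_pt_end_directed.
  exists 1%N, (fun i => if i is 0%N then unitI0 R else unitI1 R); split.
  - split=> // -[|//] _; rewrite unitI_val0 unitI_val1; exact: ltr01.
  - move=> i _; apply: chr_pole; case: i => [|i]; rewrite ?tau0 ?tau1; by [left|right].
  - move=> [|//] _; exists n, c; split; first exact: ltnSn.
    exists (fun s => gpt d (tau s)); split=> //.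
      apply: continuous_subspaceT.
      by apply: continuous_gpt_comp tc; exact: cst_continuous.
    by move=> s s' _ _ /tm; exact: glob_le_gpt.
(* Over an interior point of the disk, a height strictly between the poles gives an interior point
   of the cell, whereas a constant path would stay in X^0. *)
apply: cyl_pt_nonconstant => -[x xE].
have [s [s0 s1]] := unitI_IVT tc tau0 tau1.
suff /gsphere_incl_range : range (@gsphere_incl R n) (gpt d (tau s)).
  by case=> // -[].
apply: (chr_skel_range (c := c)); rewrite xE -(xE (unitI0 R)) tau0.
by apply: (@skel_le _ _ 0%N) => //; apply: chr_pole; left.
Qed.

(** For n > 0, X^n * [0, 1] consists of X^(n-1) * [0, 1], which maps into [cyl_skel n], and of the
    products of the n-cells with [0, 1], which the prisms parametrize through [cyl_disk]. For n = 0
    each slice is everything or empty, because the time is collapsed. *)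
Lemma closed_cyl_prism n (E : set (cyl X)) :
  (forall c : cyl_cell n, closed (@cyl_chr R X n c @^-1` E)) ->
  closed [set p : X * unitI R | (E `&` cyl_skel n) (cyl_pt p.1 p.2)] ->
  closed [set p : X * unitI R | E (cyl_pt p.1 p.2) /\ skel X n p.1].
Proof.
case: n => [|n] Ec Eq.
  apply: closed_prod_sub_skel0 => [x s []//|x].
  have cst s : cyl_pt x s = cyl_pt x (unitI0 R) \/ ~ skel X 0 x.
    by have [x0|] := pselect (skel X 0 x); [left; apply/cyl_ptP; split=> //; left|right].
  have [[Ex x0]|nE] := pselect (E (cyl_pt x (unitI0 R)) /\ skel X 0 x).
    rewrite (_ : mkset _ = setT); first exact: closedT.
    by apply/seteqP; split=> // s _ /=; case: (cst s) => // ->.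
  rewrite (_ : mkset _ = set0); first exact: closed0.
  apply/seteqP; split=> // s /= [Ex x0]; apply: nE; split=> //.
  by case: (cst s) => // <-.
apply: (@closed_prod_sub_skelS _ _ n) => [x s []//||c].
  apply: (@closed_ext _ ([set p : X * unitI R | (E `&` cyl_skel n.+1) (cyl_pt p.1 p.2)] `&`
      [set p | skel X n p.1])).
    apply: closedI => //.
    exact: closed_preimage (@continuous_fst _ _) (@closed_skel _ X n).
  move=> [x s]; split=> -[[Ex xn1] xn]; split=> //; split=> //.
    exact: skel_le xn.
  exact: cyl_skelS.
apply: closed_glob_prod.
rewrite (_ : mkset _ =
    (fun p : disk R n * unitI R * unitI R => gpt (cyl_disk p.1.1 p.2) p.1.2) @^-1`
      (chr_prism c @^-1` E)).
  apply: closed_preimage (Ec (inr c)); apply: continuous_gpt_comp.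
    apply: continuous_cyl_disk; last exact: continuous_snd.
    exact: continuous_compose (@continuous_fst _ _) (@continuous_fst _ _).
  exact: continuous_compose (@continuous_fst _ _) (@continuous_snd _ _).
apply/seteqP; split=> -[[d t] s] /=; rewrite chr_prismE cyl_disk_base cyl_disk_time.
  by case.
by split=> //; exact: chr_skelS.
Qed.

(* Working with the relative complement E of U, closed sets can be tested
   separately on the two ends and on the prism below. *)
Lemma cyl_attaching_topology n (U : set (cyl X)) :
  open (set_val @^-1` U : set (@cyl_skel R X n.+1)) <->
  open (set_val @^-1` U : set (@cyl_skel R X n)) /\
  forall c : cyl_cell n, open (@cyl_chr R X n c @^-1` U).
Proof.
split=> [Uo|[/(closed_setD_of_open (@closed_cyl_skel _ X n)) Un Uc]].
  have Ec := closed_setD_of_open (@closed_cyl_skel _ X n.+1) Uo.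
  split=> [|c].
    apply: open_of_closed_setD.
    rewrite (_ : _ `\` _ = cyl_skel n `&` (cyl_skel n.+1 `\` U)).
      by apply: closedI => //; exact: closed_cyl_skel.
    apply/seteqP; split=> v [vn]; last by move=> [].
    by split=> //; split=> //; exact: cyl_skel_le vn.
  rewrite (_ : _ @^-1` _ = ~` (cyl_chr c @^-1` (cyl_skel n.+1 `\` U))).
    by rewrite openC; apply: closed_preimage Ec; exact: continuous_cyl_chr.
  apply/seteqP; split=> u /=; first by move=> Uu [].
  by move=> h; apply: contrapT => nU; apply: h; split=> //; exact: cyl_chr_skelS.
apply: open_of_closed_setD; apply: closed_cyl.
set E := cyl_skel n.+1 `\` U.
have Ec c : closed (@cyl_chr R X n c @^-1` E).
  rewrite (_ : _ @^-1` _ = ~` (cyl_chr c @^-1` U)).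
    by rewrite closedC.
  apply/seteqP; split=> u /=; first by move=> [].
  by split=> //; exact: cyl_chr_skelS.
have En : closed (E `&` cyl_skel n).
  rewrite (_ : _ `&` _ = cyl_skel n `\` U)//.
  apply/seteqP; split=> v; first by move=> [[]].
  by move=> [vn nU]; split=> //; split=> //; exact: cyl_skel_le vn.
have Eq : closed [set p : X * unitI R | (E `&` cyl_skel n) (cyl_pt p.1 p.2)].
  exact: (closed_preimage continuous_cyl_pt En).
pose F := [set p : X * unitI R | E (cyl_pt p.1 p.2)].
(* At a fixed end the set is a copy of a closed set of X, tested on X^n and on the cells carrying
   the end faces. *)
have ends b : closed [set p : X * unitI R | F p /\ skel X n.+1 p.1 /\ p.2 = end_time b].
  pose C := [set x | skel X n.+1 x /\ E (cyl_pt x (end_time b))].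
  have Cc : closed C.
    apply: (@closed_sub_skelS _ _ n) => [x []//||c].
      rewrite (_ : _ `&` _ = skel X n `&` (fun x => cyl_pt x (end_time b)) @^-1` (E `&` cyl_skel n)).
        apply: closedI; first exact: closed_skel.
        apply: closed_preimage En.
        by apply: continuous_cyl_pt_comp; [exact: continuous_id|exact: cst_continuous].
      apply/seteqP; split=> x /=.
        move=> [[xn1 Ex] xn]; split=> //; split=> //.
        by apply/cyl_skel_pt; split=> //; case: (b); [exact: Or32|exact: Or31].
      by move=> [xn [Ex _]]; split=> //; split=> //; exact: skel_le xn.
    have := Ec (inl (c, b)); congr closed; apply/seteqP; split=> u /=.
      by split=> //; exact: chr_skelS.
    by move=> [].
  rewrite (_ : mkset _ = [set p | C p.1] `&` [set p | p.2 = end_time b]).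
    apply: closedI; first exact: closed_preimage (@continuous_fst _ _) Cc.
    exact: closed_snd_eq.
  apply/seteqP; split=> -[x s] /=.
    by move=> [Fx [xn se]]; split=> //; split=> //; rewrite -se.
  by move=> [[xn Ex] se]; rewrite se.
have prism := closed_cyl_prism Ec Eq.
rewrite (_ : mkset _ =
    [set p | F p /\ skel X n.+1 p.1 /\ p.2 = end_time false] `|`
    ([set p | F p /\ skel X n.+1 p.1 /\ p.2 = end_time true] `|`
     [set p | F p /\ skel X n p.1])).
  by apply: closedU (ends false) _; exact: closedU (ends true) prism.
apply/seteqP; split=> -[x s]; last by move=> [[]|[[]|[]]].
move=> Fx; have [/cyl_skel_pt[xn h] _] := Fx.
by case: h => h; [left|right; left|right; right]; split.
Qed.

Lemma cyl_attaching n : obtained_by_attaching (@cyl_skel R X n) (cyl_skel n.+1)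
  (@gsphere_incl R n) (@cyl_att R X n) (@cyl_chr R X n).
Proof.
split.
- exact: continuous_cyl_att.
- apply/seteqP; split=> [v [[w|[c d]] _ <-] /=|v].
  + exact/cyl_skel_le/set_valP.
  + exact: cyl_chr_skelS.
  rewrite (cyl_ptE v); move: (cyl_base v) (cyl_time v) => x s.
  have inA : cyl_skel n (cyl_pt x s) ->
      range (attaching_map (A := cyl_skel n) (@cyl_chr R X n)) (cyl_pt x s).
    by move=> xs; exists (inl (SigSub (mem_set xs) : cyl_skel n)) => //=; exact: set_val_mk.
  move=> /cyl_skel_pt[xn1 h].
  (* A point at an end is reached by an end face, a point over X^n by a prism, unless it already
     lies in [cyl_skel n]. *)
  have [[b sb]|xn] : (exists b, s = end_time b) \/ skel X n x.
  + by case: h => [->|->|]; [left; exists false|left; exists true|right].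
  + case/skelS: xn1 => [xn|[c [d ->]]]; last by exists (inr (inl (c, b), d)) => //=; rewrite sb.
    by apply: inA; apply/cyl_skel_pt; split=> //; rewrite sb; case: b {sb}; [exact: Or32|exact: Or31].
  case: n xn {xn1 h} inA => [|n] xn inA.
    by apply: inA; apply/cyl_skel_pt; split=> //; exact: Or33.
  case/skelS: xn => [xn|[c [d ->]]]; first exact/inA/cyl_skelS.
  exists (inr (inr c, glob_map (fun e => cyl_disk e s) d)) => //=.
  exact: chr_prism_map.
- apply/attaching_kernelP; split.
  + by move=> c s; rewrite cyl_attE.
  + exact: cyl_chr_range.
  + by move=> c u c' u'; exact: cyl_chr_inj.
- exact: cyl_attaching_topology.
Qed.

Lemma cyl_skel0_discrete (U : set (@cyl_skel R X 0)) : open U.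
Proof.
have -> : U = set_val @^-1` (set_val @` U).
  apply/seteqP; split=> v /=; first by exists v.
  by move=> [w Uw vw]; have <- : w = v by exact: val_inj.
apply: open_of_closed_setD; apply: closed_cyl.
set E := _ `\` _.
pose A := [set x | E (cyl_pt x (unitI0 R))].
rewrite (_ : mkset _ = fst @^-1` A).
  apply: closed_preimage; first exact: continuous_fst.
  by apply: closed_sub_skel0 => x [/cyl_skel_pt[]].
apply/seteqP; split=> -[x s] /=; rewrite /A /=.
  move=> Ex; have [/cyl_skel_pt[x0 _] _] := Ex.
  by rewrite (_ : cyl_pt x _ = cyl_pt x s)//; apply/cyl_ptP; split=> //; left.
move=> Ex; have [/cyl_skel_pt[x0 _] _] := Ex.
by rewrite (_ : cyl_pt x _ = cyl_pt x (unitI0 R))//; apply/cyl_ptP; split=> //; left.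
Qed.

Lemma cyl_att_ends n (c : cyl_cell n) (u : gsphere R n) :
  gsphere_iota u \/ gsphere_sigma u -> cyl_skel 0 (set_val (@cyl_att R X n c u)).
Proof.
move=> /gsphere_incl_polar[d [t [E te]]]; rewrite cyl_attE E.
case: c => [[c b]|c].
  by apply/cyl_skel_pt; split; [exact: chr_pole|apply/Or33/chr_pole].
case: n u c d E => [u []|n u c d E].
rewrite [cyl_chr _ _]chr_prismE; apply/cyl_skel_pt.
by split; [exact: chr_pole|apply/Or33/chr_pole].
Qed.

Lemma cyl_skel_exhaustive : \bigcup_n @cyl_skel R X n = setT.
Proof.
apply/seteqP; split=> // v _; rewrite (cyl_ptE v).
have [n xn] := skel_ex (cyl_base v).
by exists n.+1 => //; exact: cyl_skelS.
Qed.

Lemma cyl_weak_topology (U : set (cyl X)) :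
  open U <-> forall n, open (set_val @^-1` U : set (@cyl_skel R X n)).
Proof.
split=> [Uo n|Un]; first by exists U.
rewrite -[U]setCK openC; apply: closed_cyl; apply: closed_prod_skel_weak => n.
have := closed_setD_of_open (@closed_cyl_skel _ X n.+1) (Un n.+1).
move=> /(closed_preimage continuous_cyl_pt) Ec.
apply: (@closed_ext _ ([set p : X * unitI R | (cyl_skel n.+1 `\` U) (cyl_pt p.1 p.2)] `&`
    [set p | skel X n p.1])).
  apply: closedI Ec _.
  exact: closed_preimage (@continuous_fst _ _) (@closed_skel _ X n).
move=> [x s]; split=> /= -[h xn]; split=> //; first by case: h.
by split=> //; exact: cyl_skelS.
Qed.

Definition cylinder : globCW R :=
  GlobCW cyl_skel0_discrete cyl_attaching cyl_att_ends cyl_att_directed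
    cyl_skel_exhaustive cyl_weak_topology.

End cylinder_complex.

(** * Execution paths *)

Section chains.
Context {R : realType} {X : globCW R}.
Implicit Types (gamma : unitI R -> X) (a b c : unitI R).

(* On a nonconstant path, [chain gamma 0 1] means that gamma is an execution
   path; unlike subdivisions, chains are easy to cut and concatenate. *)
Definition piece gamma a b : Prop :=
  [/\ (a : R) < (b : R), skel X 0 (gamma a), skel X 0 (gamma b) &
      exists n (e : cell X n) (delta : unitI R -> gdisk R n),
        [/\ continuous delta,
            forall s s' : unitI R, (s : R) <= (s' : R) -> glob_le (delta s) (delta s') &
            forall s, unitI_itv a b s -> gamma s = chr e (delta s)]].

Inductive chain gamma a : unitI R -> Prop :=
| chain_piece b : piece gamma a b -> chain gamma a b
| chain_rcons b c : chain gamma a b -> piece gamma b c -> chain gamma a c.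

Lemma piece_lt gamma a b : piece gamma a b -> (a : R) < (b : R).
Proof. by case. Qed.

Lemma chain_lt gamma a b : chain gamma a b -> (a : R) < (b : R).
Proof. by elim=> {b} [b /piece_lt//|b c _ ab /piece_lt]; exact: lt_trans. Qed.

Lemma piece_sub gamma a b a' b' : piece gamma a b ->
  (a : R) <= (a' : R) -> (a' : R) < (b' : R) -> (b' : R) <= (b : R) ->
  skel X 0 (gamma a') -> skel X 0 (gamma b') -> piece gamma a' b'.
Proof.
move=> [ab _ _ [n [e [delta [dc dm dE]]]]] aa' ab' bb' a0 b0; split=> //.
exists n, e, delta; split=> // s /andP[as_ sb]; apply: dE.
by rewrite /unitI_itv /= (le_trans aa' as_) (le_trans sb bb').
Qed.

Lemma piece_ext gamma gamma' a b :
  (forall s, unitI_itv a b s -> gamma s = gamma' s) ->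
  piece gamma a b -> piece gamma' a b.
Proof.
move=> E [ab a0 b0 [n [e [delta [dc dm dE]]]]]; split=> //.
- by rewrite -E// /unitI_itv /= lexx ltW.
- by rewrite -E// /unitI_itv /= lexx ltW.
by exists n, e, delta; split=> // s abs; rewrite -E// dE.
Qed.

Lemma chain_ext gamma gamma' a b :
  (forall s, unitI_itv a b s -> gamma s = gamma' s) ->
  chain gamma a b -> chain gamma' a b.
Proof.
move=> E ab; elim: ab E => {b} [b ab|b c ab IH bc] E.
  by apply: chain_piece; exact: piece_ext ab.
have [ab' bc'] := (chain_lt ab, piece_lt bc).
apply: (@chain_rcons _ _ b).
  apply: IH => s /andP[as_ sb]; apply: E.
  by rewrite /unitI_itv /= as_ (le_trans sb (ltW bc')).
apply: piece_ext bc => s /andP[bs sc]; apply: E.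
by rewrite /unitI_itv /= sc (le_trans (ltW ab') bs).
Qed.

Lemma chain_trans gamma a b c : chain gamma a b -> chain gamma b c -> chain gamma a c.
Proof.
move=> ab; elim=> {c} [c bc|c d _ IH cd]; first exact: chain_rcons bc.
exact: chain_rcons IH cd.
Qed.

Lemma chain_sub gamma u v : chain gamma u v -> forall a b,
  (u : R) <= (a : R) -> (a : R) < (b : R) -> (b : R) <= (v : R) ->
  skel X 0 (gamma a) -> skel X 0 (gamma b) -> chain gamma a b.
Proof.
elim=> {v} [v uv a b ua ab bv a0 b0|w v uw IH wv a b ua ab bv a0 b0].
  by apply: chain_piece; exact: piece_sub uv _ _ _ _ _.
have [bw|wb] := leP (b : R) (w : R); first exact: IH.
have [wa|aw] := leP (w : R) (a : R).
  by apply: chain_piece; exact: piece_sub wv _ _ _ _ _.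
have w0 : skel X 0 (gamma w) by case: wv.
apply: (@chain_rcons _ _ w); first exact: IH.
exact: piece_sub wv _ _ _ _ _.
Qed.

Let clip_endr a b c (s : unitI R) : (a : R) <= (b : R) -> (b : R) <= (c : R) ->
  unitI_itv b c s -> clip a b s = b.
Proof.
move=> ab bc /andP[bs sc]; apply: unitI_inj; rewrite mk_unitIE.
by rewrite min_r// max_r.
Qed.

Let clip_endl b c (s : unitI R) : (s : R) <= (b : R) -> (b : R) <= (c : R) -> clip b c s = b.
Proof.
move=> sb bc; apply: unitI_inj; rewrite mk_unitIE.
by rewrite min_l ?max_l// (le_trans sb).
Qed.

(** The directed map is stopped at b by [clip]: a constant stretch prolongs the piece and needs none
    of its own. *)
Lemma piece_const gamma a b c : piece gamma a b -> (b : R) <= (c : R) ->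
  (forall s, unitI_itv b c s -> gamma s = gamma b) -> piece gamma a c.
Proof.
move=> [ab a0 b0 [n [e [delta [dc dm dE]]]]] bc cst; split=> //.
- exact: lt_le_trans bc.
- by rewrite cst// /unitI_itv /= lexx bc.
exists n, e, (delta \o clip a b); split.
- exact: continuous_compose (continuous_clip (a := a) (b := b)) dc.
- by move=> s s' ss'; apply: dm; exact: clip_homo.
move=> s /andP[as_ sc] /=; have [sb|bs] := leP (s : R) (b : R).
  by rewrite clip_id ?dE// /unitI_itv /= as_ sb.
have bcs : unitI_itv b c s by rewrite /unitI_itv /= sc ltW.
rewrite (clip_endr (ltW ab) bc bcs) cst// dE// /unitI_itv /= lexx.
by rewrite ltW.
Qed.

Lemma const_piece gamma a b c : (a : R) <= (b : R) -> piece gamma b c ->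
  (forall s, unitI_itv a b s -> gamma s = gamma b) -> piece gamma a c.
Proof.
move=> ab [bc b0 c0 [n [e [delta [dc dm dE]]]]] cst; split=> //.
- exact: le_lt_trans bc.
- by rewrite cst// /unitI_itv /= lexx ab.
exists n, e, (delta \o clip b c); split.
- exact: continuous_compose (continuous_clip (a := b) (b := c)) dc.
- by move=> s s' ss'; apply: dm; exact: clip_homo.
move=> s /andP[as_ sc] /=; have [bs|sb] := leP (b : R) (s : R).
  by rewrite clip_id ?dE// /unitI_itv /= bs sc.
rewrite (clip_endl (ltW sb) (ltW bc)) cst; last by rewrite /unitI_itv /= as_ ltW.
by rewrite dE// /unitI_itv /= lexx ltW.
Qed.

Lemma chain_const gamma a b c : chain gamma a b -> (b : R) <= (c : R) ->
  (forall s, unitI_itv b c s -> gamma s = gamma b) -> chain gamma a c.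
Proof.
case=> {b} [b ab|b d ab bd] bc cst.
  by apply: chain_piece; exact: piece_const ab _ _.
by apply: chain_rcons ab _; exact: piece_const bd _ _.
Qed.

Lemma const_chain gamma a b c : (a : R) <= (b : R) -> chain gamma b c ->
  (forall s, unitI_itv a b s -> gamma s = gamma b) -> chain gamma a c.
Proof.
move=> ab bc cst; elim: bc => {c} [c bc|c d _ IH cd].
  by apply: chain_piece; exact: const_piece bc _.
exact: chain_rcons IH cd.
Qed.

Lemma piecewise_directed_chain gamma :
  piecewise_directed (skel X 0) (@chr R X) setT gamma <->
  chain gamma (unitI0 R) (unitI1 R).
Proof.
split.
  move=> [k [t [[k0 t0 tk tlt] X0 tc]]].
  suff H i : (i < k)%N -> chain gamma (t 0%N) (t i.+1).
    by rewrite -t0 -tk -(prednK k0); apply: H; rewrite prednK.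
  elim: i => [|i IHi] ik.
    apply: chain_piece; split; [exact: tlt|exact: X0|exact: X0|].
    have [n [e [_ /directed_in_cellP]]] := tc _ ik.
    by move=> /(_ (ltW (tlt _ ik))) d; exists n, e.
  apply: chain_rcons (IHi (ltnW ik)) _.
  split; [exact: tlt|exact/X0/ltnW|exact: X0|].
  have [n [e [_ /directed_in_cellP]]] := tc _ ik.
  by move=> /(_ (ltW (tlt _ ik))) d; exists n, e.
move=> H; suff [k [t [k0 t0 tk tp]]] : exists k (t : nat -> unitI R),
    [/\ (0 < k)%N, t 0%N = unitI0 R, t k = unitI1 R &
        forall i, (i < k)%N -> piece gamma (t i) (t i.+1)].
  exists k, t; split; first by split=> // i /tp/piece_lt.
    move=> i; rewrite leq_eqVlt => /predU1P[->|/tp[]//].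
    by have := tp k.-1; rewrite prednK// => /(_ (leqnn _))[].
  move=> i ik; have [tlt _ _ [n [e d]]] := tp _ ik.
  by exists n, e; split=> //; exact/(directed_in_cellP _ _ (ltW tlt)).
elim: H => {} [b ab|b c _ [k [t [k0 t0 tk tp]]] bc].
  exists 1%N, (fun i => if i is 0%N then unitI0 R else b); split=> // -[|//] _.
  exact: ab.
exists k.+1, (fun i => if (i <= k)%N then t i else c); split=> //.
- by rewrite ltnn.
- move=> i; rewrite ltnS leq_eqVlt => /predU1P[->|ik].
    by rewrite eqxx ltnn tk.
  by rewrite ik orbT; exact: tp.
Qed.

Lemma execution_path_chain gamma : nonconstant gamma ->
  execution_path gamma <-> continuous gamma /\ chain gamma (unitI0 R) (unitI1 R).
Proof.
move=> nc; split=> -[gc h]; split=> //.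
  case: h => [/piecewise_directed_chain//|[x _ gx]].
  by case: nc; exists x.
by left; exact/piecewise_directed_chain.
Qed.

End chains.

(** * Homotopies as morphisms from the cylinder *)

Section morphisms_from_the_cylinder.
Context {R : realType} {X Y : globCW R}.
Variable H : X * unitI R -> Y.
Hypothesis H_cont : continuous H.
Hypothesis H_mor : forall t, is_glCW_morphism (fun x => H (x, t)).

(** The path followed by x stays in Y^0, which is discrete, and the interval is connected. *)
Lemma homotopy_skel0 x s : skel X 0 x -> H (x, s) = H (x, unitI0 R).
Proof.
move=> x0; pose h s : skel Y 0 := SigSub (mem_set (let: And3 _ h _ := H_mor s in h x x0)).
have hE t : set_val (h t) = H (x, t) by exact: set_val_mk.
have hc : continuous h.
  apply: continuous_set_type.
  rewrite (_ : set_val \o h = fun t => H (x, t)); last by apply/funext => t; exact: hE.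
  apply: (continuous_compose (f := fun t => (x, t))) H_cont.
  by apply: continuous_pair; [exact: cst_continuous|exact: continuous_id].
have hO (U : set (skel Y 0)) : open (h @^-1` U).
  by move/continuousP: hc; apply; exact: skel0_discrete.
have E : h @^-1` [set h (unitI0 R)] = setT.
  apply: unitI_connected.
  - by exists (unitI0 R).
  - by exists (h @^-1` [set h (unitI0 R)]); [exact: hO|rewrite setTI].
  - exists (h @^-1` [set h (unitI0 R)]); last by rewrite setTI.
    by rewrite -openC; exact: (hO (~` [set h (unitI0 R)])).
have : (h @^-1` [set h (unitI0 R)]) s by rewrite E.
by move=> /= /(congr1 set_val); rewrite !hE.
Qed.

Definition cyl_lift (v : cylinder X) : Y := H (cyl_base v, cyl_time v).

Lemma cyl_lift_pt x s : cyl_lift (cyl_pt x s) = H (x, s).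
Proof.
by rewrite /cyl_lift /=; case: asboolP => // x0; rewrite homotopy_skel0.
Qed.

Lemma continuous_cyl_lift : continuous cyl_lift.
Proof.
apply: continuous_cyl.
rewrite (_ : (fun p => _) = H)//.
by apply/funext => -[x s]; exact: cyl_lift_pt.
Qed.

Lemma cylinder_piece (gamma : unitI R -> cylinder X) a b : piece gamma a b ->
  exists n (c : cell X n) (delta : unitI R -> gdisk R n) r,
    [/\ continuous delta,
        forall s s' : unitI R, (s : R) <= (s' : R) -> glob_le (delta s) (delta s') &
        forall s, unitI_itv a b s -> gamma s = cyl_pt (chr c (delta s)) r].
Proof.
move=> [_ _ _ [n [[[c e]|c] [delta [dc dm dE]]]]].
  by exists n, c, delta, (end_time e).
case: n c delta dc dm dE => [[]|n c delta dc dm dE].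
have [z [tau [tc tm tE]]] := directed_fibre dc dm.
exists n, c, (fun s => gpt (disk_base z) (tau s)), (disk_time z); split.
- by apply: continuous_gpt_comp tc; exact: cst_continuous.
- by move=> s s' /tm; exact: glob_le_gpt.
- by move=> s /dE ->; rewrite tE [LHS]chr_prismE.
Qed.

Section lifting_paths.
Variable gamma : unitI R -> cylinder X.

(** A morphism is only controlled on nonconstant paths, so constant pieces need an alternative of
    their own. Recording two distinct values makes nonconstancy survive concatenation. *)
Let lifted (a b : unitI R) : Prop :=
  (forall s, unitI_itv a b s -> gamma s = gamma a) \/
  (chain (cyl_lift \o gamma) a b /\
   exists s s', [/\ unitI_itv a b s, unitI_itv a b s' &
     cyl_lift (gamma s) <> cyl_lift (gamma s')]).

Let lifted_piece a b : piece gamma a b -> lifted a b.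
Proof.
move=> ab_piece; have [ab a0 b0 _] := ab_piece.
have [n [c [delta [r [dc dm dE]]]]] := cylinder_piece ab_piece.
(* The path in X below the piece, held constant outside [a, b] so that it lives on the whole
   interval, where [H_mor] applies. *)
pose kappa s := chr c (delta (clip a b s)).
have aab : unitI_itv a b a by rewrite /unitI_itv /= lexx ltW.
have bab : unitI_itv a b b by rewrite /unitI_itv /= lexx ltW.
have kE s : unitI_itv a b s -> gamma s = cyl_pt (kappa s) r.
  by move=> abs; rewrite dE// /kappa clip_id.
have k0 s : unitI_itv a b s -> skel (cylinder X) 0 (gamma s) -> skel X 0 (kappa s).
  by move=> abs; rewrite kE// => /cyl_skel_pt[].
have lE s : unitI_itv a b s -> cyl_lift (gamma s) = H (kappa s, r).
  by move=> abs; rewrite kE// cyl_lift_pt.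
have kclip s : kappa (clip a b s) = kappa s.
  by rewrite /kappa (clip_id (clip_itv s (ltW ab))).
have cdc : continuous (fun s => delta (clip a b s)).
  exact: continuous_compose (@continuous_clip R a b) dc.
have clip0 : clip a b (unitI0 R) = a.
  by apply: unitI_inj; rewrite mk_unitIE unitI_val0 min_l ?unitI_ge0// max_l// unitI_ge0.
have clip1 : clip a b (unitI1 R) = b.
  by apply: unitI_inj; rewrite mk_unitIE unitI_val1 min_r ?unitI_le1// max_r// ltW.
have [[x kx]|nc] := pselect (exists x, forall s, kappa s = x).
  by left=> s abs; rewrite !kE// !kx.
right; have k_exec : execution_path kappa.
  apply/execution_path_chain => //; split.
    exact: continuous_compose cdc (@continuous_chr _ _ _ c).
  apply: chain_piece; split.
  - by rewrite unitI_val0 unitI_val1 ltr01.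
  - by rewrite -kclip clip0; exact: k0.
  - by rewrite -kclip clip1; exact: k0.
  exists n, c, (fun s => delta (clip a b s)); split=> // s s' ss'.
  by apply: dm; exact: clip_homo.
have [_ H0 Hexec] := H_mor r.
have [Hk_exec Hk_nc] := Hexec _ k_exec nc.
split.
  have [_ Hk_chain] := (execution_path_chain Hk_nc).1 Hk_exec.
  apply: (@chain_ext _ _ (fun s => H (kappa s, r))).
    by move=> s abs /=; rewrite lE.
  (* The chain over the whole interval may be cut at a and b, whose images are in the 0-skeleton of
     Y. *)
  apply: (chain_sub Hk_chain) => //.
  - by rewrite unitI_val0 unitI_ge0.
  - by rewrite unitI_val1 unitI_le1.
  - by apply: H0; exact: k0.
  - by apply: H0; exact: k0.
apply: contrapT => N; apply: Hk_nc; exists (H (kappa a, r)) => s.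
apply: contrapT => ne; apply: N; exists (clip a b s), a; split=> //.
  exact/clip_itv/ltW.
by rewrite !lE//; [rewrite kclip|exact/clip_itv/ltW].
Qed.

Let lifted_trans (a b c : unitI R) : (a : R) <= (b : R) -> (b : R) <= (c : R) ->
  lifted a b -> lifted b c -> lifted a c.
Proof.
move=> ab bc.
have sub1 s : unitI_itv a b s -> unitI_itv a c s.
  by move=> /andP[as_ sb]; rewrite /unitI_itv /= as_ (le_trans sb bc).
have sub2 s : unitI_itv b c s -> unitI_itv a c s.
  by move=> /andP[bs sc]; rewrite /unitI_itv /= sc (le_trans ab bs).
have bab : unitI_itv a b b by rewrite /unitI_itv /= ab lexx.
move=> [ca|[ha [s [s' [abs abs' ne]]]]] [cb|[hb [u [u' [bcu bcu' ne']]]]].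
- left=> s /andP[as_ sc]; have [sb|bs] := leP (s : R) (b : R).
    by apply: ca; rewrite /unitI_itv /= as_ sb.
  by rewrite cb ?ca// /unitI_itv /= sc ltW.
- right; split; last by exists u, u'; split=> //; exact: sub2.
  by apply: (const_chain ab hb) => s abs /=; rewrite ca// [in RHS]ca.
- right; split; last by exists s, s'; split=> //; exact: sub1.
  by apply: (chain_const ha bc) => t bct /=; rewrite cb.
- right; split; last by exists s, s'; split=> //; exact: sub1.
  exact: chain_trans ha hb.
Qed.

Lemma chain_cyl_lift : chain gamma (unitI0 R) (unitI1 R) -> nonconstant gamma ->
  chain (cyl_lift \o gamma) (unitI0 R) (unitI1 R) /\ nonconstant (cyl_lift \o gamma).
Proof.
move=> ch nc; suff [cst|[h [s [s' [_ _ ne]]]]] : lifted (unitI0 R) (unitI1 R).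
- exfalso; apply: nc; exists (gamma (unitI0 R)) => s; apply: cst.
  by rewrite /unitI_itv /= unitI_val0 unitI_val1 unitI_ge0 unitI_le1.
- split=> // -[u uE]; apply: ne.
  by rewrite -[LHS]/((cyl_lift \o gamma) s) uE -(uE s').
elim: {nc} ch => [b|b c /chain_lt ab IH bc]; first exact: lifted_piece.
apply: lifted_trans IH (lifted_piece bc); first exact: ltW.
exact/ltW/(piece_lt bc).
Qed.

End lifting_paths.

Lemma cyl_lift_morphism : is_glCW_morphism cyl_lift.
Proof.
split; first exact: continuous_cyl_lift.
  move=> v; rewrite {1}(cyl_ptE v) => /cyl_skel_pt[v0 _].
  by have [_ H0 _] := H_mor (cyl_time v); exact: H0.
move=> gamma ge nc; have [gc gch] := (execution_path_chain nc).1 ge.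
have [ch nc'] := chain_cyl_lift gch nc; split=> //.
apply/execution_path_chain => //; split=> //.
exact: continuous_compose gc continuous_cyl_lift.
Qed.

End morphisms_from_the_cylinder.

(** * The projection of the cylinder as an S-homotopy equivalence *)

Section cylinder_maps.
Context {R : realType} (X : globCW R).

Lemma cyl_pt_morphism r : is_glCW_morphism (fun x : X => cyl_pt x r : cylinder X).
Proof.
split.
- by apply: continuous_cyl_pt_comp; [exact: continuous_id|exact: cst_continuous].
- by move=> x x0; apply/cyl_skel_pt; split=> //; exact: Or33.
move=> gamma [gc ge] nc; split; last exact: cyl_pt_nonconstant.
split.
  by apply: continuous_cyl_pt_comp gc _; exact: cst_continuous.
left; case: ge => [|[x _ gx]]; last by case: nc; exists x.
exact: cyl_pt_directed.
Qed.

Definition cyl_incl r : glCW_hom X (cylinder X) := GlCWHom (cyl_pt_morphism r).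

Lemma fst_morphism (t : unitI R) : is_glCW_morphism (fun x : X => (x, t).1).
Proof. exact: glCW_id_proof. Qed.

Definition cyl_proj : glCW_hom (cylinder X) X :=
  GlCWHom (cyl_lift_morphism (@continuous_fst _ _) fst_morphism).

Lemma cyl_proj_incl r : glCW_comp cyl_proj (cyl_incl r) = glCW_id X.
Proof. exact: glCW_hom_eq. Qed.

Lemma S_homotopic_refl (Y Z : globCW R) (f : glCW_hom Y Z) : S_homotopic f f.
Proof.
exists (fun p => f p.1); split=> //; last by move=> t; exact: (glCW_funP f).
apply: continuous_compose (@continuous_fst _ _) _.
by case: (glCW_funP f).
Qed.

(** For fixed u this is a homotopy in the time variable, so it lifts to an endomorphism of the
    cylinder: the projection followed by the inclusion at time 0 if u = 0, the identity if u = 1.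
    Letting u vary gives the contraction. *)
Let scale (u : unitI R) (p : X * unitI R) : cylinder X := cyl_pt p.1 (unitI_mul p.2 u).

Let continuous_scale u : continuous (scale u).
Proof.
apply: continuous_cyl_pt_comp; first exact: continuous_fst.
apply: (continuous_compose (f := fun p : X * unitI R => (p.2, u))) continuous_unitI_mul.
by apply: continuous_pair; [exact: continuous_snd|exact: cst_continuous].
Qed.

Lemma cyl_proj_equivalence : S_homotopy_equivalence cyl_proj.
Proof.
exists (cyl_incl (unitI0 R)); rewrite cyl_proj_incl; split.
  exact: S_homotopic_refl.
exists (fun p : cylinder X * unitI R => cyl_lift (scale p.2) p.1).
have scale_mor u t : is_glCW_morphism (fun x => scale u (x, t)).
  exact: (cyl_pt_morphism (unitI_mul t u)).
split.
- apply: continuous_cyl_prod.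
  rewrite (_ : (fun p => _) = fun p : X * unitI R * unitI R =>
      cyl_pt p.1.1 (unitI_mul p.1.2 p.2)).
    apply: continuous_cyl_pt_comp.
      exact: continuous_compose (@continuous_fst _ _) (@continuous_fst _ _).
    apply: (continuous_compose (f := fun p : X * unitI R * unitI R => (p.1.2, p.2)))
      continuous_unitI_mul.
    apply: continuous_pair; last exact: continuous_snd.
    exact: continuous_compose (@continuous_fst _ _) (@continuous_snd _ _).
  apply/funext => -[[x s] u] /=.
  exact: (cyl_lift_pt (@continuous_scale u) (scale_mor u)).
- by move=> v; rewrite /cyl_lift /scale /= unitI_mul0.
- by move=> v; rewrite /cyl_lift /scale /= unitI_mul1 -cyl_ptE.
- by move=> u; exact: (cyl_lift_morphism (@continuous_scale u) (scale_mor u)).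
Qed.

End cylinder_maps.

(** * The homotopy category *)

(** Sharing the object map [o] avoids any transport of morphisms along equalities of objects. *)
Lemma functor_eq (B D : category) (o : B -> D)
    (m m' : forall X Y : B, hom X Y -> hom (o X) (o Y)) i i' c c' :
  (forall X Y (f : hom X Y), m X Y f = m' X Y f) ->
  @Functor B D o m i c = @Functor B D o m' i' c'.
Proof.
move=> mm'; have E : m = m'.
  apply: functional_extensionality_dep => X.
  apply: functional_extensionality_dep => Y.
  by apply/funext => f; exact: mm'.
subst m'; by rewrite (Prop_irrelevance i i') (Prop_irrelevance c c').
Qed.

Definition inverts_S (R : realType) (C : category) (F : functor (glCW R) C) : Prop :=
  forall (X Y : glCW R) (s : hom X Y),
    S_homotopy_equivalence s -> invertible (fmor F s).

(* The ends of the cylinder are both sections of the equivalence cyl_proj. *)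
Lemma inverts_S_homotopic (R : realType) (C : category) (F : functor (glCW R) C)
    (X Y : glCW R) (f g : hom X Y) :
  inverts_S F -> S_homotopic f g -> fmor F f = fmor F g.
Proof.
move=> invF [H [Hc Hf Hg Hm]].
have [q [qp _]] := invF _ _ _ (cyl_proj_equivalence X).
have Fincl r : fmor F (cyl_incl X r : hom (X : glCW R) (cylinder X : glCW R)) = q.
  rewrite -[LHS]comp_id_l -qp -comp_assoc -fmor_comp.
  by rewrite [X in fmor F X]cyl_proj_incl fmor_id comp_id_r.
pose h : @hom (glCW R) (cylinder X) Y := GlCWHom (cyl_lift_morphism Hc Hm).
have hE r : comp_hom h (cyl_incl X r) = GlCWHom (Hm r).
  apply: glCW_hom_eq; apply/funext => x.
  exact: (cyl_lift_pt Hc Hm).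
have -> : f = comp_hom h (cyl_incl X (unitI0 R)).
  by rewrite hE; apply: glCW_hom_eq; apply/funext => x /=.
have -> : g = comp_hom h (cyl_incl X (unitI1 R)).
  by rewrite hE; apply: glCW_hom_eq; apply/funext => x /=.
by rewrite !fmor_comp !Fincl.
Qed.

Section homotopy_category.
Context {R : realType}.
Implicit Types X Y Z : globCW R.

(** The quantification over all categories is harmless for size because [Prop] is impredicative: the
    classes are predicates on a small hom-set and again form a small type. *)
Definition S_equiv X Y (f g : glCW_hom X Y) : Prop :=
  forall (C : category) (F : functor (glCW R) C),
    inverts_S F -> @fmor _ _ F X Y f = @fmor _ _ F X Y g.

Definition ho_hom X Y : Type@{Topological.axioms_.u0} :=
  {P : glCW_hom X Y -> Prop | exists f, P = S_equiv f}.

Definition ho_class X Y (f : glCW_hom X Y) : ho_hom X Y :=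
  exist _ (S_equiv f) (ex_intro _ f erefl).

Definition ho_repr X Y (u : ho_hom X Y) : glCW_hom X Y := sval (cid (svalP u)).

Lemma ho_hom_eq X Y (u v : ho_hom X Y) : sval u = sval v -> u = v.
Proof.
case: u v => [P p] [Q q] /= PQ; subst Q.
by rewrite (Prop_irrelevance p q).
Qed.

Lemma ho_reprK X Y (u : ho_hom X Y) : ho_class (ho_repr u) = u.
Proof.
apply: ho_hom_eq; rewrite /ho_repr; by case: cid.
Qed.

Lemma ho_classP X Y (f g : glCW_hom X Y) :
  ho_class f = ho_class g <-> S_equiv f g.
Proof.
split=> [[E]|fg]; first by have : S_equiv g g by []; rewrite -E.
apply: ho_hom_eq; apply/funext => k; apply/propext.
split=> h C F invF; first by rewrite -(fg _ _ invF) h.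
by rewrite (fg _ _ invF) h.
Qed.

Lemma ho_repr_class X Y (f : glCW_hom X Y) : S_equiv (ho_repr (ho_class f)) f.
Proof. exact/ho_classP/ho_reprK. Qed.

Definition ho_comp X Y Z (v : ho_hom Y Z) (u : ho_hom X Y) : ho_hom X Z :=
  ho_class (glCW_comp (ho_repr v) (ho_repr u)).

Lemma ho_comp_class X Y Z (g : glCW_hom Y Z) (f : glCW_hom X Y) :
  ho_comp (ho_class g) (ho_class f) = ho_class (glCW_comp g f).
Proof.
apply/ho_classP => C F invF.
rewrite (fmor_comp F (ho_repr (ho_class g)) (ho_repr (ho_class f))).
by rewrite (ho_repr_class g invF) (ho_repr_class f invF) -(fmor_comp F g f).
Qed.

Program Definition HoS : category :=
  {| obj := globCW R;
     hom := ho_hom;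
     id_hom := fun X => ho_class (glCW_id X);
     comp_hom := ho_comp |}.
Next Obligation.
move=> X Y u; rewrite -(ho_reprK u) ho_comp_class; congr ho_class.
exact: glCW_hom_eq.
Qed.
Next Obligation.
move=> X Y u; rewrite -(ho_reprK u) ho_comp_class; congr ho_class.
exact: glCW_hom_eq.
Qed.
Next Obligation.
move=> W X Y Z w v u; rewrite -(ho_reprK w) -(ho_reprK v) -(ho_reprK u).
by rewrite !ho_comp_class; congr ho_class; exact: glCW_hom_eq.
Qed.

Program Definition QS : functor (glCW R) HoS :=
  {| fobj := fun X => X; fmor := ho_class |}.
Next Obligation. by []. Qed.
Next Obligation. by move=> X Y Z g f /=; rewrite ho_comp_class. Qed.

Lemma QS_homotopic X Y (f g : glCW_hom X Y) : S_homotopic f g ->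
  ho_class f = ho_class g.
Proof. by move=> fg; apply/ho_classP => C F invF; exact: inverts_S_homotopic. Qed.

Section lift.
Context {C : category} (F : functor (glCW R) C) (invF : inverts_S F).

Program Definition ho_lift : functor HoS C :=
  {| fobj := fun X => F X;
     fmor := fun X Y u => @fmor _ _ F X Y (ho_repr u) |}.
Next Obligation.
move=> X; exact: etrans (ho_repr_class (glCW_id X) invF) (fmor_id F X).
Qed.
Next Obligation.
move=> X Y Z v u.
apply: etrans (ho_repr_class (glCW_comp (ho_repr v) (ho_repr u)) invF) _.
exact: (fmor_comp F (ho_repr v) (ho_repr u)).
Qed.

End lift.

End homotopy_category.

Theorem theorem4p7 (R : realType) :
  exists (HoS : category) (QS : functor (glCW R) HoS),
    (forall (X Y : glCW R) (s : hom X Y),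
      S_homotopy_equivalence s -> invertible (fmor QS s)) /\
    (forall (C : category) (F : functor (glCW R) C),
      (forall (X Y : glCW R) (s : hom X Y),
        S_homotopy_equivalence s -> invertible (fmor F s)) ->
      exists! G : functor HoS C, F = comp_functor G QS).
Proof.
exists HoS, QS; split.
  move=> X Y s [g [sg gs]]; exists (ho_class g).
  by split; rewrite /= ho_comp_class; exact: QS_homotopic.
move=> C F invF; exists (ho_lift invF); split.
  case: F invF => o m i c invF; apply: functor_eq => X Y f.
  exact/esym/(ho_repr_class f invF).
(* Once F is the composite of G with [QS], the object maps of G and of [ho_lift] agree by
   conversion. On morphisms G is determined because each morphism is the class of its
   representative. *)
move=> G FE; subst F; case: G invF => o m i c invF.
by apply: functor_eq => X Y u /=; rewrite ho_reprK.
Qed.
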